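(* Let $0\le\alpha<1$. Then the function $h_\alpha(z)=k_\alpha(z)/z$ (with $h_\alpha(0)=1$) maps the unit disk $\mathbb{D}$ univalently onto a convex domain.
   Context: $\mathbb{D}=\{z\in\mathbb{C}:|z|<1\}$. For $0\le\alpha<1$, the function $k_\alpha$ is the analytic function on $\mathbb{D}$ given by $k_\alpha(z)=(1-2\alpha)^{-1}\left[(1-z)^{2\alpha-1}-1\right]$ if $\alpha\neq 1/2$ and $k_{1/2}(z)=-\log(1-z)$, where principal branches are used (so that $k_\alpha(0)=0$, $k_\alpha'(0)=1$). The function $k_\alpha(z)/z$ is extended analytically to $z=0$ by the value $1$. Univalent means injective and analytic. *)

(* Defs.v *)
From Stdlib Require Import Reals.
From Coquelicot Require Import Coquelicot.
Open Scope R_scope.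

Definition unit_disk (z : C) : Prop := Cmod z < 1.

Definition Cexp (z : C) : C := (exp (Re z) * cos (Im z), exp (Re z) * sin (Im z)).

(* Principal argument, with values in (-PI, PI]; the value at 0 is irrelevant. *)
Definition Carg (z : C) : R :=
  if Rle_dec 0 (Im z) then acos (Re z / Cmod z) else - acos (Re z / Cmod z).

Definition Clog (z : C) : C := (ln (Cmod z), Carg z).

(* Principal branch of z ^ a for a real exponent a and z <> 0. *)
Definition Crpower (z : C) (a : R) : C := Cexp (RtoC a * Clog z)%C.

Definition kfun (alpha : R) (z : C) : C :=
  if Req_dec_T alpha (1 / 2) then (- Clog (1 - z))%C
  else (/ RtoC (1 - 2 * alpha) * (Crpower (1 - z) (2 * alpha - 1) - 1))%C.

Definition hfun (alpha : R) (z : C) : C :=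
  if Ceq_dec z 0 then 1%C else (kfun alpha z / z)%C.

(* Complex differentiability at every point; meant for open D. *)
Definition analytic_on (D : C -> Prop) (f : C -> C) : Prop :=
  forall z : C, D z -> @ex_derive C_AbsRing C_NormedModule f z.

Definition injective_on (D : C -> Prop) (f : C -> C) : Prop :=
  forall z w : C, D z -> D w -> f z = f w -> z = w.

Definition univalent_on (D : C -> Prop) (f : C -> C) : Prop :=
  analytic_on D f /\ injective_on D f.

Definition image_set (f : C -> C) (D : C -> Prop) (w : C) : Prop :=
  exists z : C, D z /\ f z = w.

Definition connected_set (S : C -> Prop) : Prop :=
  forall U V : C -> Prop,
    open U -> open V ->
    (forall z, S z -> U z \/ V z) ->
    (exists z, S z /\ U z) -> (exists z, S z /\ V z) ->
    exists z, S z /\ U z /\ V z.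

Definition is_domain (S : C -> Prop) : Prop :=
  (exists z, S z) /\ open S /\ connected_set S.

Definition convex_set (S : C -> Prop) : Prop :=
  forall (z w : C) (t : R), S z -> S w -> 0 <= t <= 1 ->
    S (RtoC (1 - t) * z + RtoC t * w)%C.

(* Main.v *)
Require Import Defs.
From Stdlib Require Import Reals Lra Classical ClassicalEpsilon.
From Coquelicot Require Import Coquelicot.
Open Scope R_scope.

(** Put b = 2 - 2 alpha and w = 1 - z, so that k' = w^(-b), and write h' = (b/2) w^(-b-1) q.
The key estimate is |q(z) - 1| <= |z|: up to elementary factors, 1 - q is the integral of
u^2 (1-u)^(-b-2) from 0 to z, and along the path u = s z / (1 - z + s z) the integrand is
dominated by a multiple of s^b because |1 - z + s z| >= s. Hence q takes values in the right
half-plane and Re (2/q - 1) > 0, which is the convexity condition Re (1 + z h''/h') > 0.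
On a circle |z| = r the vector z h' therefore has an argument that increases by exactly 2 pi
in one turn, so each real linear functional of h is unimodal on the circle. As h' never
vanishes, its maximum over the closed disk is on the circle, and one gets
Re ((h(z) - h(w)) conj(z h'(z))) > 0 for |w| <= |z|, w <> z.
This gives injectivity. It also shows that, for y on a chord of the image of a smaller disk,
|h - y| cannot be minimal on the circle, and at an interior minimum h = y since h' <> 0. *)

(** * Derivatives with respect to a coordinate *)

(* Derivative of [f] at [x] with respect to the complex coordinate [i]: complex
   differentiability for [i = id], differentiability of a curve in C for [i = RtoC]. *)
Definition derives {X : Type} (i : X -> C) (f : X -> C) (x : X) (d : C) : Prop :=
  forall eps, 0 < eps -> exists delta, 0 < delta /\
    forall y, Cmod (i y - i x) < delta ->
      Cmod (f y - f x - d * (i y - i x)) <= eps * Cmod (i y - i x).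

Notation cderives := (derives (fun z : C => z)).
Notation rderives := (derives RtoC).

Section Derives.

Context {X : Type} (i : X -> C).

(** Source of the concrete derivatives: for the inverse, the exponential and the logarithm the error
    of the linear approximation is bounded by an explicit quadratic term. *)
Lemma derives_quadratic (f : X -> C) x d K r :
  0 < r ->
  (forall y, Cmod (i y - i x) < r ->
     Cmod (f y - f x - d * (i y - i x)) <= K * Cmod (i y - i x) ^ 2) ->
  derives i f x d.
Proof.
intros Hr H eps He.
assert (HK : 0 < Rabs K + 1) by (pose proof (Rabs_pos K); lra).
exists (Rmin r (eps / (Rabs K + 1))); split.
  apply Rmin_pos; [lra | now apply Rdiv_lt_0_compat].
intros y Hy.
assert (H1 := Rlt_le_trans _ _ _ Hy (Rmin_l _ _)).
assert (H2 := Rlt_le_trans _ _ _ Hy (Rmin_r _ _)).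
apply Rle_trans with (1 := H y H1).
set (m := Cmod (i y - i x)) in *.
assert (Hm : 0 <= m) by apply Cmod_ge_0.
assert (H3 : m * (Rabs K + 1) <= eps).
  apply Rmult_le_reg_r with (/ (Rabs K + 1)); [now apply Rinv_0_lt_compat|].
  replace (m * (Rabs K + 1) * / (Rabs K + 1)) with m by (field; lra).
  now apply Rlt_le.
assert (K <= Rabs K + 1) by (pose proof (Rle_abs K); lra).
replace (K * m ^ 2) with (K * m * m) by ring.
apply Rmult_le_compat_r; [easy|]. nra.
Qed.

Lemma derives_eq f x d e : derives i f x d -> d = e -> derives i f x e.
Proof. now intros H <-. Qed.

Lemma derives_local (f g : X -> C) x d r :
  0 < r -> (forall y, Cmod (i y - i x) < r -> f y = g y) ->
  derives i f x d -> derives i g x d.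
Proof.
intros Hr Hfg H eps He.
destruct (H eps He) as [de [Hde Hd]].
exists (Rmin r de); split; [now apply Rmin_pos|].
intros y Hy.
rewrite <- (Hfg y), <- (Hfg x).
- apply Hd. apply Rlt_le_trans with (1 := Hy), Rmin_r.
- replace (i x - i x)%C with (RtoC 0) by ring. now rewrite Cmod_0.
- apply Rlt_le_trans with (1 := Hy), Rmin_l.
Qed.

Lemma derives_ext (f g : X -> C) x d :
  (forall y, f y = g y) -> derives i f x d -> derives i g x d.
Proof. intros H. apply derives_local with 1; auto. lra. Qed.

Lemma derives_lipschitz f x d :
  derives i f x d -> exists delta, 0 < delta /\
    forall y, Cmod (i y - i x) < delta ->
      Cmod (f y - f x) <= (Cmod d + 1) * Cmod (i y - i x).
Proof.
intros H. destruct (H 1 Rlt_0_1) as [de [Hde Hd]].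
exists de; split; [easy|]. intros y Hy.
specialize (Hd y Hy).
replace (f y - f x)%C with ((f y - f x - d * (i y - i x)) + d * (i y - i x))%C by ring.
eapply Rle_trans; [apply Cmod_triangle|]. rewrite Cmod_mult. lra.
Qed.

Lemma derives_continuous f x d :
  derives i f x d -> forall eps, 0 < eps -> exists delta, 0 < delta /\
    forall y, Cmod (i y - i x) < delta -> Cmod (f y - f x) < eps.
Proof.
intros H eps He.
destruct (derives_lipschitz f x d H) as [de [Hde Hd]].
assert (HK : 0 < Cmod d + 1) by (pose proof (Cmod_ge_0 d); lra).
exists (Rmin de (eps / (Cmod d + 1))); split.
  apply Rmin_pos; [lra | now apply Rdiv_lt_0_compat].
intros y Hy.
eapply Rle_lt_trans; [apply Hd, Rlt_le_trans with (1 := Hy), Rmin_l|].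
assert (H2 := Rlt_le_trans _ _ _ Hy (Rmin_r _ _)).
apply Rmult_lt_compat_l with (r := Cmod d + 1) in H2; [|easy].
replace ((Cmod d + 1) * (eps / (Cmod d + 1))) with eps in H2 by (field; lra).
exact H2.
Qed.

Lemma derives_const c x : derives i (fun _ => c) x 0.
Proof.
apply derives_quadratic with 0 1; [lra|]. intros y _.
replace (c - c - 0 * (i y - i x))%C with (RtoC 0) by ring.
rewrite Cmod_0. lra.
Qed.

Lemma derives_index x : derives i i x 1.
Proof.
apply derives_quadratic with 0 1; [lra|]. intros y _.
replace (i y - i x - 1 * (i y - i x))%C with (RtoC 0) by ring.
rewrite Cmod_0. lra.
Qed.

Lemma derives_plus f g x d e :
  derives i f x d -> derives i g x e ->
  derives i (fun y => f y + g y)%C x (d + e)%C.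
Proof.
intros Hf Hg eps He.
destruct (Hf (eps / 2)) as [d1 [Hd1 H1]]; [lra|].
destruct (Hg (eps / 2)) as [d2 [Hd2 H2]]; [lra|].
exists (Rmin d1 d2); split; [now apply Rmin_pos|].
intros y Hy.
specialize (H1 y (Rlt_le_trans _ _ _ Hy (Rmin_l _ _))).
specialize (H2 y (Rlt_le_trans _ _ _ Hy (Rmin_r _ _))).
replace (f y + g y - (f x + g x) - (d + e) * (i y - i x))%C with
  ((f y - f x - d * (i y - i x)) + (g y - g x - e * (i y - i x)))%C by ring.
eapply Rle_trans; [apply Cmod_triangle|]. lra.
Qed.

Lemma derives_mult f g x d e :
  derives i f x d -> derives i g x e ->
  derives i (fun y => f y * g y)%C x (d * g x + f x * e)%C.
Proof.
intros Hf Hg eps He.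
pose proof (Cmod_ge_0 (f x)) as Pf. pose proof (Cmod_ge_0 (g x)) as Pg.
pose proof (Cmod_ge_0 d) as Pd. pose proof (Cmod_ge_0 e) as Pe.
set (K := 1 + Cmod (f x) + Cmod (g x) + (Cmod d + 1) * (Cmod e + 1)).
assert (HK : 0 < K) by (unfold K; nra).
assert (Hq : 0 < eps / K) by now apply Rdiv_lt_0_compat.
destruct (Hf (eps / K) Hq) as [d1 [Hd1 H1]].
destruct (Hg (eps / K) Hq) as [d2 [Hd2 H2]].
destruct (derives_lipschitz f x d Hf) as [d3 [Hd3 H3]].
destruct (derives_lipschitz g x e Hg) as [d4 [Hd4 H4]].
(* [eps / K] also serves as a radius: it turns the product of the two increments, of order [m * m],
   into a multiple of [eps / K * m]. *)
exists (Rmin (eps / K) (Rmin (Rmin d1 d2) (Rmin d3 d4))); split.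
  now repeat apply Rmin_pos.
intros y Hy.
assert (Hy0 := Rlt_le_trans _ _ _ Hy (Rmin_l _ _)).
assert (Hy' := Rlt_le_trans _ _ _ Hy (Rmin_r _ _)).
assert (Hy1 := Rlt_le_trans _ _ _ Hy' (Rmin_l _ _)).
assert (Hy2 := Rlt_le_trans _ _ _ Hy' (Rmin_r _ _)).
specialize (H1 y (Rlt_le_trans _ _ _ Hy1 (Rmin_l _ _))).
specialize (H2 y (Rlt_le_trans _ _ _ Hy1 (Rmin_r _ _))).
specialize (H3 y (Rlt_le_trans _ _ _ Hy2 (Rmin_l _ _))).
specialize (H4 y (Rlt_le_trans _ _ _ Hy2 (Rmin_r _ _))).
replace (f y * g y - f x * g x - (d * g x + f x * e) * (i y - i x))%C with
  ((f y - f x - d * (i y - i x)) * g x + f x * (g y - g x - e * (i y - i x))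
   + (f y - f x) * (g y - g x))%C by ring.
eapply Rle_trans; [apply Cmod_triangle|].
eapply Rle_trans; [apply Rplus_le_compat_r, Cmod_triangle|].
rewrite !Cmod_mult.
set (m := Cmod (i y - i x)) in *.
assert (Hm : 0 <= m) by apply Cmod_ge_0.
assert (A1 : Cmod (f y - f x - d * (i y - i x)) * Cmod (g x) <= eps / K * m * Cmod (g x))
  by now apply Rmult_le_compat_r.
assert (A2 : Cmod (f x) * Cmod (g y - g x - e * (i y - i x)) <= Cmod (f x) * (eps / K * m))
  by now apply Rmult_le_compat_l.
assert (A3 : Cmod (f y - f x) * Cmod (g y - g x) <=
  ((Cmod d + 1) * m) * ((Cmod e + 1) * m))
  by (apply Rmult_le_compat; auto using Cmod_ge_0).
assert (A4 : ((Cmod d + 1) * m) * ((Cmod e + 1) * m) <=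
  (Cmod d + 1) * (Cmod e + 1) * (eps / K * m)).
  replace (((Cmod d + 1) * m) * ((Cmod e + 1) * m)) with
    ((Cmod d + 1) * (Cmod e + 1) * (m * m)) by ring.
  apply Rmult_le_compat_l; [nra|]. apply Rmult_le_compat_r; lra.
replace (eps * m) with ((eps / K * m) * K) by (field; lra).
assert (0 <= eps / K * m) by (apply Rmult_le_pos; lra).
set (c := eps / K * m) in *. unfold K. nra.
Qed.

Lemma derives_comp f g x d e :
  derives i f x d -> cderives g (f x) e ->
  derives i (fun y => g (f y)) x (e * d)%C.
Proof.
intros Hf Hg eps He.
pose proof (Cmod_ge_0 d) as Pd. pose proof (Cmod_ge_0 e) as Pe.
set (K := Cmod d + 1 + Cmod e).
assert (HK : 0 < K) by (unfold K; lra).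
assert (Hq : 0 < eps / K) by now apply Rdiv_lt_0_compat.
destruct (Hf (eps / K) Hq) as [d1 [Hd1 H1]].
destruct (Hg (eps / K) Hq) as [d2 [Hd2 H2]].
destruct (derives_lipschitz f x d Hf) as [d3 [Hd3 H3]].
destruct (derives_continuous f x d Hf d2 Hd2) as [d4 [Hd4 H4]].
exists (Rmin d1 (Rmin d3 d4)); split.
  now repeat apply Rmin_pos.
intros y Hy.
assert (Hy' := Rlt_le_trans _ _ _ Hy (Rmin_r _ _)).
specialize (H1 y (Rlt_le_trans _ _ _ Hy (Rmin_l _ _))).
specialize (H3 y (Rlt_le_trans _ _ _ Hy' (Rmin_l _ _))).
specialize (H2 (f y) (H4 y (Rlt_le_trans _ _ _ Hy' (Rmin_r _ _)))).
replace (g (f y) - g (f x) - e * d * (i y - i x))%C with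
  ((g (f y) - g (f x) - e * (f y - f x)) + e * (f y - f x - d * (i y - i x)))%C by ring.
eapply Rle_trans; [apply Cmod_triangle|]. rewrite Cmod_mult.
set (m := Cmod (i y - i x)) in *.
replace (eps * m) with (eps / K * ((Cmod d + 1) * m) + Cmod e * (eps / K * m))
  by (unfold K; field; fold K; lra).
apply Rplus_le_compat.
- eapply Rle_trans; [apply H2|]. apply Rmult_le_compat_l; lra.
- now apply Rmult_le_compat_l.
Qed.

End Derives.

Lemma cderives_Cinv (w : C) : w <> 0 -> cderives Cinv w (- / (w * w))%C.
Proof.
intros Hw. assert (Pw := proj1 (Cmod_gt_0 w) Hw).
apply derives_quadratic with (2 / Cmod w ^ 3) (Cmod w / 2); [lra|].
intros u Hu.
assert (Lu : Cmod w / 2 <= Cmod u).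
  pose proof (Cmod_triangle (w - u) u) as T.
  replace (w - u + u)%C with w in T by ring.
  replace (w - u)%C with (- (u - w))%C in T by ring.
  rewrite Cmod_opp in T. lra.
assert (Hu0 : u <> RtoC 0) by (apply Cmod_gt_0; lra).
replace (/ u - / w - - / (w * w) * (u - w))%C with
  ((u - w) * (u - w) * / (u * w * w))%C by (field; auto).
rewrite !Cmod_mult, Cmod_inv, !Cmod_mult by (repeat apply Cmult_neq_0; auto).
set (m := Cmod (u - w)) in *.
replace (2 / Cmod w ^ 3 * m ^ 2) with (m * m * (/ (Cmod w / 2 * Cmod w * Cmod w)))
  by (field; lra).
apply Rmult_le_compat_l; [apply Rle_0_sqr|].
apply Rinv_le_contravar; [|repeat apply Rmult_le_compat_r; lra].
repeat apply Rmult_lt_0_compat; lra.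
Qed.

Lemma derives_inv {X : Type} (i f : X -> C) x d :
  f x <> RtoC 0 -> derives i f x d ->
  derives i (fun y => / f y)%C x (- d / (f x * f x))%C.
Proof.
intros Hx Hf.
eapply derives_eq; [apply (derives_comp i f Cinv); [exact Hf | now apply cderives_Cinv]|].
field; auto.
Qed.

Lemma ex_derive_cderives f z d :
  cderives f z d -> @ex_derive C_AbsRing C_NormedModule f z.
Proof.
intros H. exists d. split; [apply is_linear_scal_l|].
intros x Hx.
(* Coquelicot's differential quantifies over all limits of the filter of neighbourhoods of [z]; by
   separation [z] is the only one. *)
assert (E : z = x) by exact (@is_filter_lim_locally_unique C_AbsRing (AbsRing_NormedModule C_AbsRing) z x Hx). subst x. clear Hx.
intros eps. destruct (H eps (cond_pos eps)) as [de [Hde Hd]].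
exists (mkposreal de Hde). intros y Hy.
specialize (Hd y Hy).
rewrite (Cmult_comm d) in Hd. exact Hd.
Qed.

Lemma rderives_Re g t d : rderives g t d -> is_derive (fun s => Re (g s)) t (Re d).
Proof.
intros H. apply is_derive_Reals. intros eps He.
destruct (H (eps / 2)) as [de [Hde Hd]]; [lra|].
exists (mkposreal de Hde). intros h Hh Hhd. simpl in Hhd.
specialize (Hd (t + h)).
replace (RtoC (t + h) - RtoC t)%C with (RtoC h) in Hd
  by (rewrite RtoC_plus; ring).
rewrite Cmod_R in Hd. specialize (Hd Hhd).
pose proof (re_le_Cmod (g (t + h)%R - g t - d * RtoC h)) as B.
replace (Re (g (t + h)%R - g t - d * RtoC h)) with
  (Re (g (t + h)%R) - Re (g t) - Re d * h) in B.
2:{ unfold Re; simpl; ring. }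
assert (Ph : 0 < Rabs h) by now apply Rabs_pos_lt.
replace ((Re (g (t + h)) - Re (g t)) / h - Re d) with
  ((Re (g (t + h)) - Re (g t) - Re d * h) / h) by (field; easy).
unfold Rdiv at 1. rewrite Rabs_mult, Rabs_inv.
apply Rmult_lt_reg_r with (Rabs h); [easy|].
rewrite Rmult_assoc, Rinv_l, Rmult_1_r by lra. nra.
Qed.

Lemma rderives_pair (x y : R -> R) t dx dy :
  is_derive x t dx -> is_derive y t dy -> rderives (fun s => (x s, y s)) t (dx, dy).
Proof.
intros Hx Hy eps He.
apply is_derive_Reals in Hx. apply is_derive_Reals in Hy.
destruct (Hx (eps / 2)) as [d1 H1]; [lra|].
destruct (Hy (eps / 2)) as [d2 H2]; [lra|].
exists (Rmin d1 d2); split; [apply Rmin_pos; apply cond_pos|].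
intros s Hs.
replace (RtoC s - RtoC t)%C with (RtoC (s - t)) in * by now rewrite RtoC_minus.
rewrite Cmod_R in *.
destruct (Req_dec s t) as [->|Hst].
  replace ((x t, y t) - (x t, y t) - (dx, dy) * RtoC (t - t))%C with (RtoC 0).
    rewrite Cmod_0. apply Rmult_le_pos; [lra|apply Rabs_pos].
  apply injective_projections; simpl; ring.
specialize (H1 (s - t) ltac:(lra) (Rlt_le_trans _ _ _ Hs (Rmin_l _ _))).
specialize (H2 (s - t) ltac:(lra) (Rlt_le_trans _ _ _ Hs (Rmin_r _ _))).
replace (t + (s - t)) with s in * by ring.
replace ((x s, y s) - (x t, y t) - (dx, dy) * RtoC (s - t))%C with
  (RtoC ((x s - x t) / (s - t) - dx) * RtoC (s - t)
   + Ci * (RtoC ((y s - y t) / (s - t) - dy) * RtoC (s - t)))%C.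
2:{ apply injective_projections; simpl; field; lra. }
eapply Rle_trans; [apply Cmod_triangle|].
rewrite !Cmod_mult, Cmod_Ci, !Cmod_R.
pose proof (Rabs_pos (s - t)). nra.
Qed.

(** * Compactness and mean value inequality *)

(** Compactness of a square containing [K], in the form used twice below: a local size can be made
    uniform when [Q] passes to smaller sizes. The local condition is imposed at every point of the
    plane; off a closed [K] it holds vacuously near the point. *)
Lemma bounded_uniform (K : C -> Prop) (M : R) (Q : C -> R -> Prop) :
  (forall z, K z -> Cmod z <= M) ->
  (forall z d e, 0 < d <= e -> Q z e -> Q z d) ->
  (forall p, exists d, 0 < d /\ forall u, K u -> Cmod (u - p) < d -> Q u d) ->
  exists d, 0 < d /\ forall u, K u -> Q u d.
Proof.
intros HM HQ Hloc.
(* The local radius is halved because the compactness theorem controls the two coordinates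
   separately: two coordinates within [d] give a distance below [2 * d]. *)
assert (Hch : forall p : C, {d : posreal | forall u, K u -> Cmod (u - p) < 2 * d -> Q u d}).
  intros p. apply constructive_indefinite_description.
  destruct (Hloc p) as [d [Hd H]].
  assert (Hd2 : 0 < d / 2) by lra.
  exists (mkposreal _ Hd2). simpl. intros u Ku Hu.
  apply HQ with d; [lra|]. apply H; auto. lra.
destruct (compactness_value_2d (- M) M (- M) M (fun x y => proj1_sig (Hch (x, y)))) as [d Hd].
exists d; split; [apply cond_pos|]. intros u Ku.
pose proof (Rmax_Cmod u) as Hmax. specialize (HM u Ku).
pose proof (Rmax_l (Rabs (fst u)) (Rabs (snd u))).
pose proof (Rmax_r (Rabs (fst u)) (Rabs (snd u))).
destruct (NNPP _ (Hd (fst u) (snd u) ltac:(apply Rabs_le_between; lra)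
  ltac:(apply Rabs_le_between; lra))) as (x & y & _ & _ & Hx & Hy & Hdd).
destruct (Hch (x, y)) as [e He]; simpl in *.
apply HQ with e; [split; [apply cond_pos | exact Hdd]|].
apply He; auto.
replace (u - (x, y))%C with (RtoC (fst u - x) + Ci * RtoC (snd u - y))%C.
2:{ apply injective_projections; simpl; ring. }
eapply Rle_lt_trans; [apply Cmod_triangle|].
rewrite Cmod_mult, Cmod_Ci, !Cmod_R. lra.
Qed.

(** Uniformity is used twice. It first gives a lower bound, written [- / d] so as to be monotone in
    [d]. Then, if the infimum [- m] were not attained, [f] would exceed it by a fixed [d] on all of
    [K], contradicting its definition. *)
Lemma attains_min (K : C -> Prop) (M : R) (f : C -> R) :
  (forall z, K z -> Cmod z <= M) ->
  (forall z, ~ K z -> exists d, 0 < d /\ forall u, Cmod (u - z) < d -> ~ K u) ->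
  (exists z, K z) ->
  (forall z, K z -> forall eps, 0 < eps -> exists d, 0 < d /\
     forall u, Cmod (u - z) < d -> Rabs (f u - f z) < eps) ->
  exists p, K p /\ forall z, K z -> f p <= f z.
Proof.
intros HM Hcl [z0 Hz0] Hf.
assert (Hbd : exists d, 0 < d /\ forall u, K u -> - / d <= f u).
  apply bounded_uniform with M; auto.
  - intros z d e [Hd He] H. apply Rle_trans with (2 := H), Ropp_le_contravar.
    now apply Rinv_le_contravar.
  - intros p. destruct (classic (K p)) as [Kp|Kp].
    + destruct (Hf p Kp 1 Rlt_0_1) as [d [Hd H]].
      pose proof (Rabs_pos (f p)) as P.
      set (e := / (Rabs (f p) + 1)).
      assert (He : 0 < e) by (apply Rinv_0_lt_compat; lra).
      exists (Rmin d e); split; [now apply Rmin_pos|].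
      intros u _ Hu.
      specialize (H u (Rlt_le_trans _ _ _ Hu (Rmin_l _ _))).
      apply Rabs_lt_between in H.
      assert (Rabs (f p) + 1 <= / Rmin d e).
        rewrite <- (Rinv_inv (Rabs (f p) + 1)).
        apply Rinv_le_contravar; [now apply Rmin_pos | apply Rmin_r].
      pose proof (Rabs_maj2 (f p)). lra.
    + destruct (Hcl p Kp) as [d [Hd H]].
      exists d; split; auto. intros u Ku Hu. now elim (H u Hu).
destruct Hbd as [d [Hd Hbd]].
destruct (completeness (fun x => exists z, K z /\ x = - f z)) as [m [Hm1 Hm2]].
  exists (/ d). intros x (z & Kz & ->). specialize (Hbd z Kz). lra.
  now exists (- f z0), z0.
apply NNPP. intros Hno.
assert (Hgt : forall p, K p -> - m < f p).
  intros p Kp. destruct (Rle_lt_dec (f p) (- m)) as [H|H]; [|easy].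
  elim Hno. exists p; split; auto. intros z Kz.
  assert (- f z <= m) by (apply Hm1; now exists z). lra.
assert (Hun : exists d, 0 < d /\ forall u, K u -> - m + d <= f u).
  apply bounded_uniform with M; auto.
  - intros z d1 e He H. lra.
  - intros p. destruct (classic (K p)) as [Kp|Kp].
    + specialize (Hgt p Kp).
      destruct (Hf p Kp ((f p + m) / 2)) as [d1 [Hd1 H]]; [lra|].
      exists (Rmin d1 ((f p + m) / 2)); split; [apply Rmin_pos; lra|].
      intros u _ Hu.
      specialize (H u (Rlt_le_trans _ _ _ Hu (Rmin_l _ _))).
      apply Rabs_lt_between in H.
      pose proof (Rmin_r d1 ((f p + m) / 2)). lra.
    + destruct (Hcl p Kp) as [d1 [Hd1 H]].
      exists d1; split; auto. intros u Ku Hu. now elim (H u Hu).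
destruct Hun as [d' [Hd' H]].
assert (m <= m - d'); [|lra].
apply Hm2. intros x (z & Kz & ->). specialize (H z Kz). lra.
Qed.

(** The real mean value theorem, applied to [Re (e * g t) - a * M t] with [e] the conjugate of the
    total increment and [a] its modulus. At the endpoints [M] is only asked to be continuous, since
    the majorant [s * Rpower s b] used later is not differentiable at 0. *)
Lemma rderives_increment (g dg : R -> C) (M m : R -> R) :
  (forall t, 0 <= t <= 1 -> rderives g t (dg t)) ->
  (forall t, 0 <= t <= 1 -> continuity_pt M t) ->
  (forall t, 0 < t < 1 -> is_derive M t (m t)) ->
  (forall t, 0 <= t <= 1 -> Cmod (dg t) <= m t) ->
  Cmod (g 1 - g 0) <= M 1 - M 0.
Proof.
intros Hg HMc HM Hm.
assert (HM01 : 0 <= M 1 - M 0).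
  destruct (MVT_gen M 0 1 m) as (c & Hc & ->).
  - rewrite Rmin_left, Rmax_right by lra. exact HM.
  - rewrite Rmin_left, Rmax_right by lra. exact HMc.
  - rewrite Rmin_left, Rmax_right in Hc by lra.
    pose proof (Hm c Hc). pose proof (Cmod_ge_0 (dg c)). nra.
set (e := Cconj (g 1 - g 0)).
set (a := Cmod e).
assert (Ha : a = Cmod (g 1 - g 0)) by apply Cmod_conj.
assert (Hr : forall t, 0 <= t <= 1 -> is_derive (fun s => Re (e * g s)) t (Re (e * dg t))).
  intros t Ht. apply (rderives_Re (fun s => e * g s)%C).
  eapply derives_eq; [apply derives_mult; [apply derives_const | apply Hg, Ht]|].
  cbv beta; ring.
destruct (MVT_gen (fun t => Re (e * g t) - a * M t) 0 1
  (fun t => Re (e * dg t) - a * m t)) as (c & Hc & Heq).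
- rewrite Rmin_left, Rmax_right by lra. intros t Ht.
  apply (is_derive_minus (fun s => Re (e * g s)) (fun s => a * M s)).
  + apply Hr. lra.
  + apply (is_derive_scal M), HM, Ht.
- rewrite Rmin_left, Rmax_right by lra. intros t Ht.
  apply continuity_pt_minus.
  + apply derivable_continuous_pt. exists (Re (e * dg t)). now apply is_derive_Reals, Hr.
  + apply continuity_pt_scal with (f := M). now apply HMc.
- rewrite Rmin_left, Rmax_right in Hc by lra.
  assert (H1 : Re (e * dg c) <= a * m c).
    eapply Rle_trans; [apply Rle_abs|].
    eapply Rle_trans; [apply re_le_Cmod|].
    rewrite Cmod_mult. apply Rmult_le_compat_l; [apply Cmod_ge_0 | now apply Hm].
  assert (H2 : Re (e * g 1) - Re (e * g 0) = a ^ 2).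
    rewrite Ha, Cmod2_alt. unfold e, Re, Im. simpl. ring.
  rewrite <- Ha. assert (0 <= a) by apply Cmod_ge_0.
  destruct (Req_dec a 0) as [->|]; [lra|].
  apply Rmult_le_reg_l with a; [lra|]. nra.
Qed.

Lemma rderives_increment_const (g dg : R -> C) (L : R) :
  (forall t, 0 <= t <= 1 -> rderives g t (dg t)) ->
  (forall t, 0 <= t <= 1 -> Cmod (dg t) <= L) ->
  Cmod (g 1 - g 0) <= L.
Proof.
intros Hg HL.
replace L with (L * 1 - L * 0) by ring.
apply (rderives_increment g dg (fun t => L * t) (fun _ => L)); auto.
- intros t _. apply derivable_continuous_pt. reg.
- intros t _. auto_derive; auto. ring.
Qed.

(** * Complex exponential, logarithm and powers *)

Lemma Cexp_plus (z w : C) : Cexp (z + w) = (Cexp z * Cexp w)%C.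
Proof.
unfold Cexp, Re, Im. apply injective_projections; simpl;
rewrite exp_plus, ?cos_plus, ?sin_plus; ring.
Qed.

Lemma Cexp_0 : Cexp 0 = 1.
Proof.
unfold Cexp, Re, Im. apply injective_projections; simpl;
rewrite exp_0, ?cos_0, ?sin_0; ring.
Qed.

Lemma Cmod_Cexp (z : C) : Cmod (Cexp z) = exp (Re z).
Proof.
unfold Cmod, Cexp; simpl. rewrite !Rmult_1_r.
replace (_ + _) with (Rsqr (exp (Re z)) * (Rsqr (sin (Im z)) + Rsqr (cos (Im z))))
  by (unfold Rsqr; ring).
rewrite sin2_cos2, Rmult_1_r. apply sqrt_Rsqr, Rlt_le, exp_pos.
Qed.

Lemma Cexp_neq_0 (z : C) : Cexp z <> 0.
Proof. apply Cmod_gt_0. rewrite Cmod_Cexp. apply exp_pos. Qed.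

Lemma Cexp_opp (z : C) : Cexp (- z) = (/ Cexp z)%C.
Proof.
pose proof (Cexp_neq_0 z).
assert (E : (Cexp z * Cexp (- z) = 1)%C).
  rewrite <- Cexp_plus, <- Cexp_0. f_equal. ring.
replace (Cexp (- z)) with (/ Cexp z * (Cexp z * Cexp (- z)))%C by (field; auto).
rewrite E. field. auto.
Qed.

Lemma rderives_Cexp_line (h : C) (t : R) :
  rderives (fun s => Cexp (RtoC s * h)) t (h * Cexp (RtoC t * h))%C.
Proof.
apply derives_ext with (fun s => (exp (s * fst h) * cos (s * snd h),
  exp (s * fst h) * sin (s * snd h))).
  intros s. unfold Cexp, Re, Im. simpl. rewrite !Rmult_0_l, Rminus_0_r, Rplus_0_r. reflexivity.
eapply derives_eq.
- apply rderives_pair; (auto_derive; [easy|reflexivity]).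
- unfold Cexp, Re, Im. apply injective_projections; simpl;
  rewrite !Rmult_0_l, Rminus_0_r, Rplus_0_r; ring.
Qed.

(** Two rounds of the mean value inequality along the segment from 0 to [h]: the first bounds
    [Cexp - 1] by [3 * Cmod h], the second integrates this bound. The 3 is an upper bound for
    [exp 1]. *)
Lemma Cexp_expansion (h : C) : Cmod h <= 1 -> Cmod (Cexp h - 1 - h) <= 3 * Cmod h ^ 2.
Proof.
intros Hh. pose proof (Cmod_ge_0 h) as Ph.
assert (H1 : forall s, 0 <= s <= 1 -> Cmod (Cexp (RtoC s * h) - 1) <= 3 * Cmod h).
  intros s Hs.
  replace (Cexp (RtoC s * h) - 1)%C with
    (Cexp (RtoC 1 * (RtoC s * h)) - Cexp (RtoC 0 * (RtoC s * h)))%C.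
  2:{ rewrite Cmult_0_l, Cexp_0. now rewrite Cmult_1_l. }
  apply (rderives_increment_const (fun t => Cexp (RtoC t * (RtoC s * h)))
    (fun t => RtoC s * h * Cexp (RtoC t * (RtoC s * h)))%C).
  - intros t _. apply rderives_Cexp_line.
  - intros t Ht. rewrite !Cmod_mult, Cmod_Cexp, Cmod_R, (Rabs_pos_eq s) by lra.
    assert (E : exp (Re (RtoC t * (RtoC s * h))) <= 3).
      assert (L : Re (RtoC t * (RtoC s * h)) <= 1).
        eapply Rle_trans; [apply Rle_abs|]. eapply Rle_trans; [apply re_le_Cmod|].
        rewrite !Cmod_mult, !Cmod_R, (Rabs_pos_eq t), (Rabs_pos_eq s) by lra.
        assert (0 <= s * Cmod h <= 1) by (split; nra). nra.
      apply Rle_trans with (2 := exp_le_3).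
      destruct L as [L| ->]; [apply Rlt_le, exp_increasing, L | lra].
    pose proof (exp_pos (Re (RtoC t * (RtoC s * h)))).
    assert (s * Cmod h <= Cmod h) by nra.
    rewrite Rmult_comm. apply Rmult_le_compat; try nra.
replace (Cexp h - 1 - h)%C with
  ((Cexp (RtoC 1 * h) - RtoC 1 * h) - (Cexp (RtoC 0 * h) - RtoC 0 * h))%C.
2:{ rewrite Cmult_0_l, Cexp_0, Cmult_1_l. ring. }
apply (rderives_increment_const (fun t => Cexp (RtoC t * h) - RtoC t * h)%C
  (fun t => h * (Cexp (RtoC t * h) - 1))%C).
- intros t _. eapply derives_eq.
  + apply derives_plus; [apply rderives_Cexp_line|].
    apply derives_ext with (fun s => - h * RtoC s)%C; [intros; ring|].
    apply derives_mult; [apply derives_const | apply derives_index].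
  + cbv beta; ring.
- intros t Ht. rewrite Cmod_mult. specialize (H1 t Ht). nra.
Qed.

Lemma cderives_Cexp (z : C) : cderives Cexp z (Cexp z).
Proof.
apply derives_quadratic with (3 * Cmod (Cexp z)) 1; [lra|].
intros u Hu.
replace (Cexp u) with (Cexp z * Cexp (u - z))%C.
2:{ rewrite <- Cexp_plus. f_equal. ring. }
replace (_ - _ - _)%C with (Cexp z * (Cexp (u - z) - 1 - (u - z)))%C by ring.
rewrite Cmod_mult.
pose proof (Cexp_expansion (u - z) (Rlt_le _ _ Hu)). pose proof (Cmod_ge_0 (Cexp z)). nra.
Qed.

(** Replaces the argument by a formula that is smooth on the right half-plane; the definition
    through [acos] changes case on the real axis, where [acos] is singular. *)
Lemma Clog_atan (w : C) : 0 < Re w -> Clog w = (ln (Cmod w), atan (Im w / Re w)).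
Proof.
intros Hw. unfold Clog, Carg. f_equal.
assert (Hm : 0 < Cmod w).
  pose proof (re_le_Cmod w). pose proof (Rle_abs (Re w)). lra.
assert (E : acos (Re w / Cmod w) = atan (Rabs (Im w) / Re w)).
  rewrite acos_atan by now apply Rdiv_lt_0_compat.
  f_equal.
  replace (1 - (Re w / Cmod w)²) with ((Rabs (Im w) / Cmod w)²).
  2:{ rewrite !Rsqr_div', <- Rsqr_abs. pose proof (Cmod2_alt w) as E.
      apply Rmult_eq_reg_r with (Cmod w ^ 2); [|apply pow_nonzero; lra].
      unfold Rsqr. field_simplify; lra. }
  rewrite sqrt_Rsqr.
  - field; lra.
  - apply Rmult_le_pos; [apply Rabs_pos | now apply Rlt_le, Rinv_0_lt_compat].
rewrite E. destruct (Rle_dec 0 (Im w)) as [H|H].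
- now rewrite Rabs_pos_eq.
- rewrite Rabs_left by lra. rewrite <- atan_opp. f_equal. field. lra.
Qed.

Lemma Cexp_Clog (w : C) : 0 < Re w -> Cexp (Clog w) = w.
Proof.
intros Hw. rewrite Clog_atan by easy. unfold Cexp; simpl.
assert (Hm : 0 < Cmod w).
  pose proof (re_le_Cmod w). pose proof (Rle_abs (Re w)). lra.
rewrite exp_ln, cos_atan, sin_atan by easy.
replace (1 + (Im w / Re w)²) with ((Cmod w / Re w)²).
2:{ rewrite !Rsqr_div'. rewrite (Rsqr_pow2 (Cmod w)), Cmod2_alt. unfold Rsqr. field. lra. }
rewrite sqrt_Rsqr by now apply Rlt_le, Rdiv_lt_0_compat.
apply injective_projections; simpl; unfold Re, Im in *; field; lra.
Qed.

Lemma rderives_Clog_line (w v : C) (t : R) :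
  0 < Re (w + RtoC t * v) ->
  rderives (fun s => (ln (Cmod (w + RtoC s * v)),
    atan (Im (w + RtoC s * v) / Re (w + RtoC s * v)))) t (v / (w + RtoC t * v))%C.
Proof.
destruct w as [a b], v as [c d]. intros H.
unfold Re in H; simpl in H.
assert (H' : 0 < a + t * c) by lra.
apply derives_ext with (fun s => (ln (sqrt ((a + s * c) ^ 2 + (b + s * d) ^ 2)),
  atan ((b + s * d) / (a + s * c)))).
  intros s. unfold Cmod, Re, Im; simpl.
  rewrite !Rmult_0_l, Rminus_0_r, !Rplus_0_r, !Rmult_1_r. reflexivity.
assert (P : 0 < (a + t * c) ^ 2 + (b + t * d) ^ 2).
  pose proof (pow2_ge_0 (b + t * d)). pose proof (pow_lt _ 2 H'). lra.
assert (P' := sqrt_lt_R0 _ P).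
set (X := a + t * c) in *. set (Y := b + t * d) in *.
apply derives_eq with ((c * X + d * Y) / (X ^ 2 + Y ^ 2), (d * X - c * Y) / (X ^ 2 + Y ^ 2)).
- apply rderives_pair.
  + auto_derive; fold X Y; replace (X * (X * 1) + Y * (Y * 1)) with (X ^ 2 + Y ^ 2) by ring.
    * auto.
    * set (S := sqrt (X ^ 2 + Y ^ 2)) in *.
      replace (X ^ 2 + Y ^ 2) with (S * S) by (apply sqrt_sqrt; lra). field. lra.
  + auto_derive; fold X Y; [lra | field].
    repeat split; simpl in P; lra.
- replace ((a, b) + RtoC t * (c, d))%C with (X, Y)
    by (apply injective_projections; simpl; unfold X, Y; ring).
  apply injective_projections; simpl; field; simpl in P; lra.
Qed.

(** The hypothesis keeps the segment from [w] to [w + v] in the right half-plane and at distance at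
    least [Cmod w / 2] from 0, since [Re w <= Cmod w]. This bounds the variation of the derivative
    [1 / w]. *)
Lemma Clog_expansion (w v : C) : Cmod v < Re w / 2 ->
  Cmod (Clog (w + v) - Clog w - / w * v) <= 2 / Cmod w ^ 2 * Cmod v ^ 2.
Proof.
intros Hv. pose proof (Cmod_ge_0 v) as Pv.
pose proof (re_le_Cmod w) as Rw. pose proof (Rle_abs (Re w)).
assert (Hre : forall t, 0 <= t <= 1 -> 0 < Re (w + RtoC t * v)).
  intros t Ht. rewrite re_plus, re_scal_l.
  pose proof (re_le_Cmod v) as Rv. apply Rabs_le_between in Rv. nra.
assert (Hnz : forall t, 0 <= t <= 1 -> (w + RtoC t * v)%C <> 0).
  intros t Ht E. specialize (Hre t Ht). rewrite E in Hre. simpl in Hre. lra.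
assert (Hw0 : w <> 0).
  intros E. rewrite E in *. simpl in *. lra.
set (L := fun u => (ln (Cmod u), atan (Im u / Re u)) : C).
replace (Clog (w + v) - Clog w - / w * v)%C with
  ((L (w + RtoC 1 * v) - / w * v * RtoC 1) - (L (w + RtoC 0 * v) - / w * v * RtoC 0))%C.
2:{ unfold L. rewrite <- !Clog_atan by (apply Hre; lra).
    rewrite Cmult_1_l, Cmult_0_l, Cplus_0_r. ring. }
apply (rderives_increment_const (fun t => L (w + RtoC t * v) - / w * v * RtoC t)%C
  (fun t => v / (w + RtoC t * v) - / w * v)%C).
- intros t Ht. eapply derives_eq.
  + apply derives_plus; [apply rderives_Clog_line, Hre, Ht|].
    apply derives_ext with (fun s => (- (/ w * v)) * RtoC s)%C; [intros; ring|].
    apply derives_mult; [apply derives_const | apply derives_index].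
  + cbv beta; ring.
- intros t Ht. specialize (Hnz t Ht).
  replace (v / (w + RtoC t * v) - / w * v)%C with
    (- (RtoC t * (v * v) * / (w * (w + RtoC t * v))))%C by (field; auto).
  assert (Hlow : Cmod w / 2 <= Cmod (w + RtoC t * v)).
    pose proof (Cmod_triangle (w + RtoC t * v) (- (RtoC t * v))) as T.
    replace (w + RtoC t * v + - (RtoC t * v))%C with w in T by ring.
    rewrite Cmod_opp, Cmod_mult, Cmod_R, Rabs_pos_eq in T by lra. nra.
  rewrite Cmod_opp, !Cmod_mult, Cmod_inv, Cmod_mult, Cmod_R, Rabs_pos_eq
    by (try apply Cmult_neq_0; auto; lra).
  assert (Pw : 0 < Cmod w) by now apply Cmod_gt_0.
  replace (2 / Cmod w ^ 2 * Cmod v ^ 2) with (Cmod v ^ 2 * / (Cmod w * (Cmod w / 2)))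
    by (field; lra).
  apply Rmult_le_compat.
  + apply Rmult_le_pos; [lra | apply Rle_0_sqr].
  + apply Rlt_le, Rinv_0_lt_compat, Rmult_lt_0_compat; lra.
  + nra.
  + apply Rinv_le_contravar; [apply Rmult_lt_0_compat; lra|].
    apply Rmult_le_compat_l; lra.
Qed.

Lemma cderives_Clog (w : C) : 0 < Re w -> cderives Clog w (/ w)%C.
Proof.
intros Hw. apply derives_quadratic with (2 / Cmod w ^ 2) (Re w / 2); [lra|].
intros u Hu. replace u with (w + (u - w))%C at 1 by ring.
now apply Clog_expansion.
Qed.

Lemma Cmod_pos_Re (w : C) : 0 < Re w -> 0 < Cmod w.
Proof. intros H. pose proof (re_le_Cmod w). pose proof (Rle_abs (Re w)). lra. Qed.

Lemma Crpower_plus (w : C) (a c : R) :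
  Crpower w (a + c) = (Crpower w a * Crpower w c)%C.
Proof. unfold Crpower. rewrite <- Cexp_plus. f_equal. rewrite RtoC_plus. ring. Qed.

Lemma Crpower_1 (w : C) : 0 < Re w -> Crpower w 1 = w.
Proof. intros H. unfold Crpower. rewrite Cmult_1_l. now apply Cexp_Clog. Qed.

Lemma Crpower_neq_0 (w : C) (a : R) : Crpower w a <> 0.
Proof. apply Cexp_neq_0. Qed.

Lemma Crpower_opp (w : C) (a : R) : Crpower w (- a) = (/ Crpower w a)%C.
Proof. unfold Crpower. rewrite <- Cexp_opp. f_equal. rewrite RtoC_opp. ring. Qed.

Lemma Cmod_Crpower (w : C) (a : R) : Cmod (Crpower w a) = Rpower (Cmod w) a.
Proof. unfold Crpower. rewrite Cmod_Cexp, re_scal_l. reflexivity. Qed.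

Lemma Crpower_at_1 (a : R) : Crpower 1 a = 1.
Proof.
unfold Crpower. rewrite Clog_atan by (simpl; lra).
replace (Im 1 / Re 1) with 0 by (simpl; field).
rewrite Cmod_1, ln_1, atan_0, <- Cexp_0. f_equal.
apply injective_projections; simpl; ring.
Qed.

Lemma cderives_Crpower (w : C) (a : R) :
  0 < Re w -> cderives (fun u => Crpower u a) w (RtoC a * Crpower w (a - 1))%C.
Proof.
intros Hw. eapply derives_eq.
- apply (derives_comp _ (fun u => RtoC a * Clog u)%C Cexp); [|apply cderives_Cexp].
  apply derives_mult; [apply derives_const | now apply cderives_Clog].
- fold (Crpower w a). cbv beta.
  unfold Rminus. rewrite Crpower_plus, Crpower_opp, Crpower_1 by easy. ring.
Qed.

(** * Circles about the origin *)

Definition circle (z : C) (t : R) : C := (z * Cexp (RtoC t * Ci))%C.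

Lemma Cexp_Ci (t : R) : Cexp (RtoC t * Ci) = (cos t, sin t).
Proof.
unfold Cexp. replace (Re (RtoC t * Ci)) with 0 by (unfold Re; simpl; ring).
replace (Im (RtoC t * Ci)) with t by (unfold Im; simpl; ring).
rewrite exp_0. f_equal; ring.
Qed.

Lemma Cmod_circle z t : Cmod (circle z t) = Cmod z.
Proof.
unfold circle. rewrite Cmod_mult, Cmod_Cexp.
replace (Re (RtoC t * Ci)) with 0 by (unfold Re; simpl; ring).
rewrite exp_0. ring.
Qed.

Lemma circle_0 z : circle z 0 = z.
Proof. unfold circle. rewrite Cmult_0_l, Cexp_0. ring. Qed.

Lemma circle_2PI z : circle z (2 * PI) = z.
Proof.
unfold circle. rewrite Cexp_Ci, cos_2PI, sin_2PI. apply Cmult_1_r.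
Qed.

Lemma rderives_circle z t : rderives (circle z) t (Ci * circle z t)%C.
Proof.
unfold circle. eapply derives_eq.
- apply derives_mult; [apply derives_const | apply rderives_Cexp_line].
- cbv beta; ring.
Qed.

Lemma circle_surj (z w : C) : 0 < Cmod z -> Cmod w = Cmod z ->
  exists t, 0 <= t <= 2 * PI /\ w = circle z t.
Proof.
intros Hz Hw. assert (Hz0 := proj2 (Cmod_gt_0 z) Hz).
assert (E : forall t, (w / z)%C = (cos t, sin t) -> w = circle z t).
  intros t Et. unfold circle. rewrite Cexp_Ci, <- Et. field. auto.
assert (H1 : Re (w / z) ^ 2 + Im (w / z) ^ 2 = 1).
  rewrite <- Cmod2_alt, Cmod_div, Hw by easy. field. lra.
destruct (w / z)%C as [x y]. unfold Re, Im in H1; simpl in H1.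
assert (Hx : -1 <= x <= 1) by nra.
pose proof (acos_bound x) as Ha. pose proof PI_RGT_0.
assert (Hs : sin (acos x) = Rabs y).
  rewrite sin_acos by easy.
  replace (1 - x²) with (y²) by (unfold Rsqr; lra). apply sqrt_Rsqr_abs.
destruct (Rle_lt_dec 0 y) as [Hy|Hy].
- exists (acos x). split; [lra|]. apply E.
  now rewrite Hs, cos_acos, Rabs_pos_eq.
- exists (- acos x + 2 * INR 1 * PI). split; [simpl; lra|]. apply E.
  rewrite cos_period, sin_period, cos_neg, sin_neg, Hs, cos_acos, Rabs_left by lra.
  f_equal. ring.
Qed.

(** * Convex sets and minima over disks *)

Lemma open_Cmod (U : C -> Prop) (z : C) : open U -> U z ->
  exists e, 0 < e /\ forall u, Cmod (u - z) < e -> U u.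
Proof.
intros HU Hz. apply HU in Hz. apply locally_C in Hz. destruct Hz as [e He].
exists e; split; [apply cond_pos|]. intros u Hu. now apply He.
Qed.

Lemma Cmod_open (U : C -> Prop) :
  (forall z, U z -> exists e, 0 < e /\ forall u, Cmod (u - z) < e -> U u) -> open U.
Proof.
intros H z Hz. apply locally_C. destruct (H z Hz) as [e [He Hu]].
exists (mkposreal e He). intros u. apply Hu.
Qed.

(** If [U] and [V] separated [S], the indicator of [U] along a segment from [U] to [V] would be
    locally constant, hence have derivative 0, and yet drop from 1 to 0. *)
Lemma convex_connected (S : C -> Prop) : convex_set S -> connected_set S.
Proof.
intros HS U V HU HV HUV [z [Sz Uz]] [w [Sw Vw]].
apply NNPP. intros Hno.
(* Clamping the parameter to [0, 1] keeps the path in [S] for every real [t], so that two-sided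
   derivatives make sense at the endpoints as well. *)
set (c := fun t => Rmax 0 (Rmin 1 t)).
assert (c01 : forall t, 0 <= c t <= 1).
  intros t. unfold c, Rmax, Rmin. repeat destruct Rle_dec; lra.
assert (c_lip : forall s t, Rabs (c s - c t) <= Rabs (s - t)).
  intros s t. unfold c, Rmax, Rmin, Rabs.
  repeat destruct Rle_dec; repeat destruct Rcase_abs; lra.
set (g := fun t => (RtoC (1 - c t) * z + RtoC (c t) * w)%C).
assert (Sg : forall t, S (g t)) by (intros t; now apply HS).
assert (g_near : forall t e, 0 < e -> exists d, 0 < d /\
    forall h, Rabs h < d -> Cmod (g (t + h)%R - g t) < e).
  intros t e He. pose proof (Cmod_ge_0 (w - z)) as P.
  exists (e / (Cmod (w - z) + 1)); split; [apply Rdiv_lt_0_compat; lra|].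
  intros h Hh. unfold g.
  replace (_ - _)%C with (RtoC (c (t + h)%R - c t) * (w - z))%C
    by (rewrite !RtoC_minus; ring).
  rewrite Cmod_mult, Cmod_R.
  pose proof (c_lip (t + h) t) as L. replace (t + h - t) with h in L by ring.
  apply Rmult_lt_compat_r with (r := Cmod (w - z) + 1) in Hh; [|lra].
  replace (e / (Cmod (w - z) + 1) * (Cmod (w - z) + 1)) with e in Hh by (field; lra).
  pose proof (Rabs_pos h). nra.
set (f := fun t => if excluded_middle_informative (U (g t)) then 1 else 0).
assert (Hf : forall t, derivable_pt_lim f t 0).
  intros t eps Heps.
  assert (Hd : exists d, 0 < d /\ forall h, Rabs h < d -> f (t + h) = f t).
    unfold f. destruct (excluded_middle_informative (U (g t))) as [Ht|Ht].
    - destruct (open_Cmod U (g t) HU Ht) as (e & He & H).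
      destruct (g_near t e He) as (d & Hd & Hg). exists d; split; auto.
      intros h Hh. destruct excluded_middle_informative as [_|Hn]; auto.
      elim Hn. apply H, Hg, Hh.
    - destruct (HUV (g t) (Sg t)) as [Ht'|Ht']; [contradiction|].
      destruct (open_Cmod V (g t) HV Ht') as (e & He & H).
      destruct (g_near t e He) as (d & Hd & Hg). exists d; split; auto.
      intros h Hh. destruct excluded_middle_informative as [Hn|_]; auto.
      elim Hno. exists (g (t + h)). repeat split; auto.
  destruct Hd as (d & Hd & H). exists (mkposreal d Hd). intros h _ Hh.
  rewrite (H h Hh). unfold Rminus, Rdiv. rewrite Rplus_opp_r, Rmult_0_l, Ropp_0, Rplus_0_r, Rabs_R0.
  exact Heps.
destruct (MVT_cor2 f (fun _ => 0) 0 1 Rlt_0_1 (fun t _ => Hf t)) as (x & E & _).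
assert (c0 : c 0 = 0) by (unfold c; rewrite Rmin_right, Rmax_left; lra).
assert (c1 : c 1 = 1) by (unfold c; rewrite Rmin_left, Rmax_right; lra).
assert (g0 : g 0 = z) by (unfold g; rewrite c0, Rminus_0_r; ring).
assert (g1 : g 1 = w) by (unfold g; rewrite c1; replace (1 - 1) with 0 by ring; ring).
unfold f in E. rewrite g0, g1 in E.
destruct (excluded_middle_informative (U z)) as [_|n]; [|contradiction].
destruct (excluded_middle_informative (U w)) as [Uw|_]; [|lra].
apply Hno. now exists w.
Qed.

Lemma is_derive_neg_decrease (f : R -> R) (x l : R) : is_derive f x l -> l < 0 ->
  exists d, 0 < d /\ forall s, 0 < s < d -> f (x + s) < f x.
Proof.
intros H Hl. apply is_derive_Reals in H.
destruct (H (- l / 2) ltac:(lra)) as [d Hd].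
exists d; split; [apply cond_pos|]. intros s Hs.
specialize (Hd s ltac:(lra) ltac:(rewrite Rabs_pos_eq; lra)).
apply Rabs_lt_between in Hd.
assert (Q : (f (x + s) - f x) / s < 0) by lra.
assert (E : f (x + s) - f x = (f (x + s) - f x) / s * s) by (field; lra).
nra.
Qed.

Lemma rderives_line (f : C -> C) (p v d : C) : cderives f p d ->
  rderives (fun s => f (p + RtoC s * v)%C) 0 (d * v)%C.
Proof.
intros H. apply (derives_comp _ (fun s => p + RtoC s * v)%C f).
- eapply derives_eq.
  + apply derives_plus; [apply derives_const|].
    apply derives_mult; [apply derives_index | apply derives_const].
  + cbv beta; ring.
- now replace (p + RtoC 0 * v)%C with p by ring.
Qed.

Lemma linear_decrease (f : C -> C) (p d c v : C) : cderives f p d -> Re (c * d * v) < 0 ->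
  exists e, 0 < e /\ forall s, 0 < s < e -> Re (c * f (p + RtoC s * v)%C) < Re (c * f p).
Proof.
intros H Hv.
destruct (is_derive_neg_decrease (fun s => Re (c * f (p + RtoC s * v)%C)) 0 (Re (c * d * v)))
  as (e & He & Hs); auto.
- apply (rderives_Re (fun s => c * f (p + RtoC s * v)%C)%C).
  eapply derives_eq; [apply derives_mult; [apply derives_const | apply rderives_line, H]|].
  cbv beta; ring.
- exists e; split; auto. intros s Hse. specialize (Hs s Hse).
  rewrite Rplus_0_l in Hs. now replace (p + RtoC 0 * v)%C with p in Hs by ring.
Qed.

(** The squared distance to [w] has derivative [2 * Re (Cconj (f p - w) * d * v)] in the direction
    [v]. *)
Lemma distance_decrease (f : C -> C) (p d w v : C) :
  cderives f p d -> Re (Cconj (f p - w) * d * v) < 0 ->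
  exists e, 0 < e /\
    forall s, 0 < s < e -> Cmod (f (p + RtoC s * v)%C - w) < Cmod (f p - w).
Proof.
intros H Hv.
set (g := fun s => (f (p + RtoC s * v)%C - w)%C).
assert (g0 : g 0 = (f p - w)%C) by (unfold g; now replace (p + RtoC 0 * v)%C with p by ring).
assert (Hg : rderives g 0 (d * v)%C).
  eapply derives_eq; [apply derives_plus; [apply rderives_line, H | apply derives_const]|].
  cbv beta; ring.
assert (HRe := rderives_Re g 0 _ Hg).
(* The imaginary part is the real part after multiplication by [- Ci], so [rderives_Re] serves for
   both coordinates. *)
assert (HIm : is_derive (fun s => Re (- Ci * g s)) 0 (Re (- Ci * (d * v)))).
  apply (rderives_Re (fun s => - Ci * g s)%C).
  eapply derives_eq; [apply derives_mult; [apply derives_const | apply Hg]|].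
  cbv beta; ring.
assert (Hsq : is_derive (fun s => Cmod (g s) ^ 2) 0 (2 * Re (Cconj (f p - w) * d * v))).
  apply is_derive_ext with (fun s => Re (g s) * Re (g s) + Re (- Ci * g s) * Re (- Ci * g s)).
    intros s. rewrite Cmod2_alt. unfold Re, Im; simpl; ring.
  replace (2 * Re (Cconj (f p - w) * d * v)) with
    ((Re (d * v) * Re (g 0) + Re (g 0) * Re (d * v)) +
     (Re (- Ci * (d * v)) * Re (- Ci * g 0) + Re (- Ci * g 0) * Re (- Ci * (d * v)))).
  2:{ rewrite g0. unfold Re, Im; simpl; ring. }
  apply (is_derive_plus (fun s => Re (g s) * Re (g s))
    (fun s => Re (- Ci * g s) * Re (- Ci * g s)));
  apply Derive.is_derive_mult; auto.
destruct (is_derive_neg_decrease _ _ _ Hsq ltac:(lra)) as (e & He & Hs).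
exists e; split; auto. intros s Hse. specialize (Hs s Hse).
rewrite Rplus_0_l, g0 in Hs. fold (g s).
pose proof (Cmod_ge_0 (g s)). pose proof (Cmod_ge_0 (f p - w)). nra.
Qed.

Lemma ball_radius (p v : C) (r : R) : Cmod p < r ->
  exists e, 0 < e /\ forall s, 0 < s < e -> Cmod (p + RtoC s * v) <= r.
Proof.
intros H. pose proof (Cmod_ge_0 v).
exists ((r - Cmod p) / (Cmod v + 1)); split; [apply Rdiv_lt_0_compat; lra|].
intros s Hs. eapply Rle_trans; [apply Cmod_triangle|].
rewrite Cmod_mult, Cmod_R, Rabs_pos_eq by lra.
destruct Hs as [Hs0 Hs]. apply Rmult_lt_compat_r with (r := Cmod v + 1) in Hs; [|lra].
replace ((r - Cmod p) / (Cmod v + 1) * (Cmod v + 1)) with (r - Cmod p) in Hs by (field; lra).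
nra.
Qed.

Lemma Cmod_triangle_rev (u z : C) : Rabs (Cmod u - Cmod z) <= Cmod (u - z).
Proof.
pose proof (Cmod_triangle (u - z) z) as T1. pose proof (Cmod_triangle (z - u) u) as T2.
replace (u - z + z)%C with u in T1 by ring. replace (z - u + u)%C with z in T2 by ring.
replace (z - u)%C with (- (u - z))%C in T2 by ring. rewrite Cmod_opp in T2.
apply Rabs_le_between. lra.
Qed.

Lemma closed_disk_complement (r : R) (z : C) : ~ Cmod z <= r ->
  exists d, 0 < d /\ forall u, Cmod (u - z) < d -> ~ Cmod u <= r.
Proof.
intros H. exists (Cmod z - r); split; [lra|]. intros u Hu.
pose proof (Cmod_triangle_rev u z) as T. apply Rabs_le_between in T. lra.
Qed.

Lemma circle_complement (r : R) (z : C) : Cmod z <> r ->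
  exists d, 0 < d /\ forall u, Cmod (u - z) < d -> Cmod u <> r.
Proof.
intros H. exists (Rabs (Cmod z - r)); split; [apply Rabs_pos_lt; lra|].
intros u Hu E. pose proof (Cmod_triangle_rev u z) as T.
rewrite E, Rabs_minus_sym in T. lra.
Qed.

(** * The quotient k(z)/z *)

Lemma cderives_pow2 (z : C) : cderives (fun u => u * u)%C z (2 * z)%C.
Proof.
eapply derives_eq; [apply derives_mult; apply derives_index|]. cbv beta; ring.
Qed.

Lemma cderives_one_minus (z : C) : cderives (fun u => 1 - u)%C z (- (1))%C.
Proof.
apply derives_ext with (fun u => 1 + - (1) * u)%C; [intros; ring|].
eapply derives_eq.
- apply derives_plus; [apply derives_const|].
  apply derives_mult; [apply derives_const | apply derives_index].
- cbv beta; ring.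
Qed.

Lemma cderives_Crpower_one_minus (z : C) (a : R) : 0 < Re (1 - z) ->
  cderives (fun u => Crpower (1 - u) a) z (- RtoC a * Crpower (1 - z) (a - 1))%C.
Proof.
intros H. eapply derives_eq.
- apply (derives_comp _ (fun u => 1 - u)%C (fun u => Crpower u a)).
  + apply cderives_one_minus.
  + now apply cderives_Crpower.
- ring.
Qed.

Lemma Re_one_minus_disk (z : C) : Cmod z < 1 -> 0 < Re (1 - z).
Proof.
intros H. pose proof (re_le_Cmod z). pose proof (Rle_abs (Re z)).
unfold Re in *. simpl. lra.
Qed.

Lemma Cmod_lt_1_neq (z : C) : Cmod z < 1 -> (1 - z)%C <> 0.
Proof. intros H. apply Cmod_gt_0, Cmod_pos_Re, Re_one_minus_disk, H. Qed.

Lemma ln_nonpos (x : R) : x <= 1 -> ln x <= 0.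
Proof.
intros Hx. destruct (Rlt_le_dec 0 x) as [H|H].
- rewrite <- ln_1. now apply ln_le.
- unfold ln. destruct (Rlt_dec 0 x); [exfalso; lra | apply Rle_refl].
Qed.

(** For [x <= 0] the convention [ln x = 0] makes the power equal to 1. The continuity proof at 0
    does meet such negative [x]. *)
Lemma Rpower_le_1 (x c : R) : x <= 1 -> 0 <= c -> Rpower x c <= 1.
Proof.
intros Hx Hc. pose proof (ln_nonpos x Hx) as H. unfold Rpower. rewrite <- exp_0.
assert (L : c * ln x <= 0) by nra.
destruct L as [L| ->]; [now apply Rlt_le, exp_increasing | lra].
Qed.

(* Written as [s * Rpower s c] rather than [Rpower s (c + 1)] because [ln 0 = 0] makes [Rpower 0 c = 1]. *)
Lemma continuity_Rpower_succ (c s : R) :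
  0 <= c -> 0 <= s -> continuity_pt (fun x => x * Rpower x c) s.
Proof.
intros Hc Hs. destruct (Req_dec s 0) as [->|Hs0].
- intros eps He. exists (Rmin 1 eps). split; [apply Rmin_pos; lra|].
  intros x [_ Hx]. simpl in *. unfold R_dist in *. rewrite Rminus_0_r in Hx.
  rewrite Rmult_0_l, Rminus_0_r.
  assert (Hx1 := Rlt_le_trans _ _ _ Hx (Rmin_l _ _)).
  assert (Hx2 := Rlt_le_trans _ _ _ Hx (Rmin_r _ _)).
  apply Rabs_lt_between in Hx1.
  pose proof (Rpower_le_1 x c ltac:(lra) Hc).
  assert (0 < Rpower x c) by apply exp_pos.
  rewrite Rabs_mult, (Rabs_pos_eq (Rpower x c)) by lra.
  pose proof (Rabs_pos x). nra.
- apply derivable_continuous_pt.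
  exists (Rpower s c + s * (c * / s * Rpower s c)). apply is_derive_Reals.
  unfold Rpower. auto_derive; [lra | ring].
Qed.

(** * The remainder estimate, for a primitive of (1 - z)^(-b) vanishing at 0 *)

Section Koebe.

(** Only the value at 0 and the derivative of [k] enter, so the logarithmic case and the power case
    are treated at once, with b = 2 - 2 alpha. *)
Context (b : R) (Hb : 0 < b <= 2) (k : C -> C) (k_0 : k 0 = 0)
  (k_deriv : forall z, 0 < Re (1 - z) -> cderives k z (Crpower (1 - z) (- b))).

Definition quotk (z : C) : C := if Ceq_dec z 0 then 1%C else (k z / z)%C.

(* The integral of b (b + 1) u^2 (1 - u)^(- b - 2) from 0 to z. *)
Definition remk (z : C) : C :=
  (2 * k z + Crpower (1 - z) (- b - 1) * (RtoC b * (z * z) - 2 * z * (1 - z)))%C.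

Lemma remk_0 : remk 0 = 0.
Proof. unfold remk. rewrite k_0. ring. Qed.

Lemma cderives_remk (z : C) : 0 < Re (1 - z) ->
  cderives remk z (RtoC (b * (b + 1)) * (z * z) * Crpower (1 - z) (- b - 2))%C.
Proof.
intros Hz. unfold remk. eapply derives_eq.
- apply derives_plus.
  + apply derives_mult; [apply derives_const | now apply k_deriv].
  + apply derives_mult; [now apply cderives_Crpower_one_minus|].
    apply derives_ext with (fun u => (RtoC b + 2) * (u * u) + - (2) * u)%C; [intros; ring|].
    apply derives_plus; (apply derives_mult; [apply derives_const|]).
    * apply cderives_pow2.
    * apply derives_index.
- cbv beta.
  (* All powers become [Crpower (1 - z) (- b - 2)] times powers of [1 - z], which leaves a
     polynomial identity. *)
  replace (- b) with (- b - 2 + 1 + 1) at 1 by ring.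
  replace (- b - 1 - 1) with (- b - 2) by ring.
  replace (- b - 1) with (- b - 2 + 1) by ring.
  rewrite !Crpower_plus, Crpower_1 by easy.
  rewrite RtoC_plus, RtoC_minus, RtoC_opp, RtoC_mult, RtoC_plus. ring.
Qed.

(** Write D = 1 - z + s z = (1 - s)(1 - z) + s. Along the path u = s z / D one has 1 - u = (1 - z) /
    D, whose real part times |D|^2 is (1 - s)|1 - z|^2 + s Re (1 - z). The bound by s comes from |D|
    >= 1 - (1 - s)|z|. *)
Lemma Re_moebius_path (z : C) (s : R) : Cmod z < 1 -> 0 <= s <= 1 ->
  0 < Re (1 - RtoC s * z / (1 - z + RtoC s * z)) /\
  s <= Cmod (1 - z + RtoC s * z) /\ 0 < Cmod (1 - z + RtoC s * z).
Proof.
intros Hz Hs.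
assert (Hlow : 1 - (1 - s) * Cmod z <= Cmod (1 - z + RtoC s * z)).
  pose proof (Cmod_triangle (1 - z + RtoC s * z) (RtoC (1 - s) * z)) as T.
  replace (1 - z + RtoC s * z + RtoC (1 - s) * z)%C with (RtoC 1) in T
    by (rewrite RtoC_minus; ring).
  rewrite Cmod_1, Cmod_mult, Cmod_R, Rabs_pos_eq in T by lra. lra.
pose proof (Cmod_ge_0 z).
assert (HD : 0 < Cmod (1 - z + RtoC s * z)) by nra.
split; [|split; [nra | easy]].
pose proof (proj2 (Cmod_gt_0 _) HD) as HD0.
replace (1 - RtoC s * z / (1 - z + RtoC s * z))%C with
  ((1 - z) / (1 - z + RtoC s * z))%C by (field; auto).
pose proof (Re_one_minus_disk z Hz) as Hre.
assert (P := pow_lt _ 2 HD). rewrite Cmod2_alt in P.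
destruct z as [x y]. unfold Re, Im in *. simpl in *.
assert (Hxy : x * x + y * y < 1).
  unfold Cmod in Hz; simpl in Hz.
  replace (x * x + y * y) with (x * (x * 1) + y * (y * 1)) by ring.
  apply Rnot_le_lt. intros H1. apply sqrt_le_1_alt in H1. rewrite sqrt_1 in H1. lra.
match goal with |- 0 < ?e => replace e with
  (((1 - s) * ((1 - x) * (1 - x) + y * y) + s * (1 - x)) /
   ((1 + - x + (s * x - 0 * y)) * ((1 + - x + (s * x - 0 * y)) * 1)
   + (0 + - y + (s * y + 0 * x)) * ((0 + - y + (s * y + 0 * x)) * 1))) by (field; lra) end.
apply Rdiv_lt_0_compat; [|lra].
assert (0 < (1 - x) * (1 - x)) by nra.
assert (0 <= y * y) by apply Rle_0_sqr.
destruct (Req_dec s 0) as [->|]; nra.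
Qed.

(** With D as in the previous lemma, u' = z (1 - z) / D^2, and the integrand along the path has
    modulus K (b + 1) s^2 |D|^(b-2). Since |D| >= s and b <= 2, this is at most K (b + 1) s^b, whose
    integral over [0, 1] is K. *)
Lemma remk_bound (z : C) : Cmod z < 1 ->
  Cmod (remk z) <= b * Cmod z ^ 3 * Rpower (Cmod (1 - z)) (- b - 1).
Proof.
intros Hz.
set (u := fun s : R => (RtoC s * z / (1 - z + RtoC s * z))%C).
assert (Hu0 : u 0 = 0). { unfold u. rewrite Cmult_0_l. unfold Cdiv. ring. }
assert (Hu1 : u 1 = z). { unfold u. rewrite Cmult_1_l. field. replace (1 - z + z)%C with (RtoC 1) by ring. intros E; injection E; lra. }
set (K := b * Cmod z ^ 3 * Rpower (Cmod (1 - z)) (- b - 1)).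
pose proof (Cmod_ge_0 z) as Pz.
assert (Hz1 := Cmod_lt_1_neq z Hz).
assert (Pw := proj1 (Cmod_gt_0 _) Hz1).
assert (HK : 0 <= K).
  unfold K, Rpower. apply Rmult_le_pos; [|apply Rlt_le, exp_pos].
  apply Rmult_le_pos; [lra | now apply pow_le].
replace (remk z) with (remk (u 1) - remk (u 0))%C.
2:{ rewrite Hu0, Hu1, remk_0. ring. }
replace K with (K * (1 * Rpower 1 b) - K * (0 * Rpower 0 b)).
2:{ unfold Rpower. rewrite ln_1, Rmult_0_r, exp_0. ring. }
apply (rderives_increment (fun s => remk (u s))
  (fun s => RtoC (b * (b + 1)) * (u s * u s) * Crpower (1 - u s) (- b - 2)
     * (z * (1 - z) / ((1 - z + RtoC s * z) * (1 - z + RtoC s * z))))%C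
  (fun s => K * (s * Rpower s b)) (fun s => K * ((b + 1) * Rpower s b))).
- intros s Hs. destruct (Re_moebius_path z s Hz Hs) as (H1 & _ & H3).
  apply Cmod_gt_0 in H3.
  apply derives_comp; [|now apply cderives_remk].
  unfold u, Cdiv. eapply derives_eq.
  + apply derives_mult.
    * apply derives_mult; [apply derives_index | apply derives_const].
    * apply derives_inv; [exact H3|].
      apply derives_plus; [apply derives_const|].
      apply derives_mult; [apply derives_index | apply derives_const].
  + cbv beta. field. auto.
- intros s Hs. apply continuity_pt_scal with (f := fun s => s * Rpower s b).
  apply continuity_Rpower_succ; lra.
- intros s Hs. unfold Rpower. auto_derive; [lra | field; lra].
- intros s Hs. destruct (Re_moebius_path z s Hz Hs) as (H1 & H2 & H3).
  pose proof (proj2 (Cmod_gt_0 _) H3) as H3'.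
  assert (Pp : 0 < Rpower s b) by apply exp_pos.
  (* The manipulation of powers of [s] below assumes [s > 0]. At 0 the left side vanishes, while
     [Rpower 0 b] is 1 by convention. *)
  destruct (Req_dec s 0) as [->|Hs0].
    rewrite Hu0. replace (_ * _)%C with (RtoC 0) by (unfold Cdiv; ring).
    rewrite Cmod_0. apply Rmult_le_pos; nra.
  assert (E1 : (1 - u s = (1 - z) / (1 - z + RtoC s * z))%C) by (unfold u; field; auto).
  rewrite E1. unfold u.
  set (D := (1 - z + RtoC s * z)%C) in *.
  assert (HDD : (D * D)%C <> 0) by now apply Cmult_neq_0.
  rewrite !Cmod_mult, Cmod_Crpower, !Cmod_div, !Cmod_mult, !Cmod_R by easy.
  rewrite (Rabs_pos_eq s), (Rabs_pos_eq (b * (b + 1))) by nra.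
  set (d := Cmod D) in *. set (a := Cmod (1 - z)) in *. set (r := Cmod z) in *.
  replace (Rpower (a / d) (- b - 2)) with (Rpower a (- b - 1) * / a * (d ^ 4 * Rpower d (b - 2))).
  2:{ replace (/ a) with (Rpower a (- (1))) by (rewrite Rpower_Ropp, Rpower_1; auto).
      replace (d ^ 4) with (Rpower d 4) by (rewrite <- (Rpower_pow 4) by easy; f_equal; simpl; ring).
      rewrite <- !Rpower_plus. unfold Rpower, Rdiv.
      rewrite ln_mult, ln_Rinv by (try apply Rinv_0_lt_compat; lra).
      rewrite <- exp_plus. f_equal. ring. }
  replace (K * ((b + 1) * Rpower s b)) with
    (K * (b + 1) * s ^ 2 * Rpower s (b - 2)).
  2:{ replace (Rpower s b) with (Rpower s (b - 2) * Rpower s 2).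
      2:{ rewrite <- Rpower_plus. f_equal. ring. }
      replace (Rpower s 2) with (s ^ 2). ring.
      rewrite <- (Rpower_pow 2) by lra. reflexivity. }
  replace (_ * _ * _) with (K * (b + 1) * s ^ 2 * Rpower d (b - 2)).
  2:{ unfold K. fold r a. field. lra. }
  apply Rmult_le_compat_l.
    apply Rmult_le_pos; [nra | apply pow2_ge_0].
  (* Here [b <= 2] enters: the exponent is nonpositive, so [s <= d] gives the reverse inequality
     between the powers. *)
  replace (b - 2) with (- (2 - b)) by ring.
  rewrite !Rpower_Ropp. apply Rinv_le_contravar; [apply exp_pos|].
  apply Rle_Rpower_l; lra.
Qed.

(* Rocq's division by 0 gives [qk 0 = 1], the analytic value. *)
Definition qk (z : C) : C :=
  (1 - Crpower (1 - z) (b + 1) * remk z / (RtoC b * (z * z)))%C.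

Definition dquotk (z : C) : C :=
  (RtoC (b / 2) * Crpower (1 - z) (- b - 1) * qk z)%C.

Lemma qk_0 : qk 0 = 1.
Proof. unfold qk. rewrite remk_0. unfold Cdiv. ring. Qed.

Lemma qk_near_1 (z : C) : Cmod z < 1 -> Cmod (qk z - 1) <= Cmod z.
Proof.
intros Hz. destruct (Ceq_dec z 0) as [->|Hz0].
  rewrite qk_0. replace (1 - 1)%C with (RtoC 0) by ring. lra.
unfold qk. replace (_ - _ - _)%C with
  (- (Crpower (1 - z) (b + 1) * remk z / (RtoC b * (z * z))))%C by ring.
assert (Hbz : (RtoC b * (z * z))%C <> 0).
  repeat apply Cmult_neq_0; auto. intros E; injection E; lra.
assert (Pz := proj1 (Cmod_gt_0 z) Hz0).
rewrite Cmod_opp, Cmod_div, !Cmod_mult, Cmod_Crpower, Cmod_R, Rabs_pos_eq by (auto; lra).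
pose proof (remk_bound z Hz) as H.
set (a := Cmod (1 - z)) in *. set (r := Cmod z) in *.
assert (E : Rpower a (b + 1) * Rpower a (- b - 1) = 1).
  rewrite <- Rpower_plus. replace (b + 1 + (- b - 1)) with 0 by ring.
  unfold Rpower. rewrite Rmult_0_l. apply exp_0.
assert (Pp : 0 < Rpower a (b + 1)) by apply exp_pos.
assert (Pd : 0 < b * (r * r)) by (apply Rmult_lt_0_compat; nra).
apply Rmult_le_reg_r with (b * (r * r)); [easy|].
unfold Rdiv. rewrite Rmult_assoc, Rinv_l, Rmult_1_r by lra.
apply Rle_trans with (Rpower a (b + 1) * (b * r ^ 3 * Rpower a (- b - 1))).
- apply Rmult_le_compat_l; lra.
- replace (Rpower a (b + 1) * (b * r ^ 3 * Rpower a (- b - 1))) with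
    (b * r ^ 3 * (Rpower a (b + 1) * Rpower a (- b - 1))) by ring.
  rewrite E. lra.
Qed.

Lemma Re_qk_pos (z : C) : Cmod z < 1 -> 0 < Re (qk z).
Proof.
intros Hz. pose proof (qk_near_1 z Hz) as H.
pose proof (re_le_Cmod (qk z - 1)) as H1.
replace (Re (qk z - 1)) with (Re (qk z) - 1) in H1 by (unfold Re; simpl; ring).
apply Rabs_le_between in H1. lra.
Qed.

(** Inversion maps the disk |q - 1| < 1 onto the half-plane Re > 1/2. *)
Lemma Re_two_div_qk (z : C) : Cmod z < 1 -> 0 < Re (2 / qk z - 1).
Proof.
intros Hz. pose proof (Re_qk_pos z Hz) as Hre.
assert (H : Cmod (qk z - 1) ^ 2 < 1).
  pose proof (qk_near_1 z Hz). pose proof (Cmod_ge_0 (qk z - 1)). nra.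
rewrite Cmod2_alt in H. destruct (qk z) as [x y].
unfold Re, Im in *. simpl in *.
assert (P : 0 < x * x + y * y) by nra.
match goal with |- 0 < ?e =>
  replace e with ((2 * x - (x * x + y * y)) / (x * x + y * y)) by (field; nra) end.
apply Rdiv_lt_0_compat; nra.
Qed.

Lemma qk_neq_0 (z : C) : Cmod z < 1 -> qk z <> 0.
Proof. intros Hz. now apply Cmod_gt_0, Cmod_pos_Re, Re_qk_pos. Qed.

Lemma dquotk_neq_0 (z : C) : Cmod z < 1 -> dquotk z <> 0.
Proof.
intros Hz. unfold dquotk. repeat apply Cmult_neq_0.
- intros E; injection E; lra.
- apply Crpower_neq_0.
- now apply qk_neq_0.
Qed.

(** * Derivatives of the quotient and of q *)

(** Isolates the singular quotient in the term [remk z / (2 * z)], which is quadratically small at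
    0. The formula includes [z = 0], where this term is 0 because [remk 0 = 0]. *)
Lemma quotk_split (z : C) : Cmod z < 1 ->
  quotk z = (Crpower (1 - z) (- b) + (- RtoC (b / 2) * z * Crpower (1 - z) (- b - 1)
    + remk z / (2 * z)))%C.
Proof.
intros Hz. unfold quotk. destruct (Ceq_dec z 0) as [->|Hz0].
- rewrite remk_0. replace (1 - 0)%C with (RtoC 1) by ring.
  rewrite !Crpower_at_1. unfold Cdiv. ring.
- unfold remk. replace (- b) with (- b - 1 + 1) at 1 by ring.
  rewrite Crpower_plus, Crpower_1 by now apply Re_one_minus_disk.
  rewrite RtoC_div by lra. field. auto.
Qed.

Lemma cderives_quotk_0 : cderives quotk 0 (dquotk 0).
Proof.
apply derives_local with (fun z => Crpower (1 - z) (- b) +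
  (- RtoC (b / 2) * z * Crpower (1 - z) (- b - 1) + remk z / (2 * z)))%C 1; [lra| |].
  intros z Hz. rewrite <- quotk_split; auto.
  replace z with (z - 0)%C by ring. exact Hz.
assert (H0 : 0 < Re (1 - 0)) by (simpl; lra).
eapply derives_eq.
- apply derives_plus; [now apply cderives_Crpower_one_minus|].
  apply derives_plus.
  + apply derives_mult; [|now apply cderives_Crpower_one_minus].
    apply derives_mult; [apply derives_const | apply derives_index].
  (* The cubic bound on [remk] leaves a quadratic one after division by [2 * u]. Radius 1/2 keeps
     [Cmod (1 - u)] above 1/2, which bounds its negative power. *)
  + apply derives_quadratic with (d := RtoC 0) (K := b / 2 * Rpower (1 / 2) (- b - 1)) (r := 1 / 2); [lra|].
    intros u Hu. rewrite remk_0.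
    replace (u - 0)%C with u in * by ring.
    replace (remk u / (2 * u) - 0 / (2 * 0) - 0 * u)%C with (remk u / (2 * u))%C
      by (unfold Cdiv; ring).
    destruct (Ceq_dec u 0) as [->|Hu0].
      rewrite remk_0. unfold Cdiv. rewrite Cmult_0_l, !Cmod_0. simpl. lra.
    assert (Pu := proj1 (Cmod_gt_0 u) Hu0).
    rewrite Cmod_div, Cmod_mult, Cmod_R, Rabs_pos_eq
      by (try apply Cmult_neq_0; auto; try lra; intros E; injection E; lra).
    pose proof (remk_bound u ltac:(lra)) as H.
    assert (Hl : 1 / 2 <= Cmod (1 - u)).
      pose proof (Cmod_triangle (1 - u) u) as T.
      replace (1 - u + u)%C with (RtoC 1) in T by ring. rewrite Cmod_1 in T. lra.
    assert (Hp : Rpower (Cmod (1 - u)) (- b - 1) <= Rpower (1 / 2) (- b - 1)).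
      replace (- b - 1) with (- (b + 1)) by ring. rewrite !Rpower_Ropp.
      apply Rinv_le_contravar; [apply exp_pos|]. apply Rle_Rpower_l; lra.
    apply Rmult_le_reg_r with (2 * Cmod u); [lra|].
    unfold Rdiv at 1. rewrite Rmult_assoc, Rinv_l, Rmult_1_r by lra.
    eapply Rle_trans; [exact H|].
    replace (b / 2 * Rpower (1 / 2) (- b - 1) * Cmod u ^ 2 * (2 * Cmod u)) with
      (b * Cmod u ^ 3 * Rpower (1 / 2) (- b - 1)) by field.
    apply Rmult_le_compat_l; [|exact Hp].
    apply Rmult_le_pos; [lra | apply pow_le; lra].
- cbv beta. unfold dquotk. rewrite qk_0.
  replace (1 - 0)%C with (RtoC 1) by ring.
  rewrite !Crpower_at_1. rewrite RtoC_opp, RtoC_div by lra. field.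
Qed.

(** Away from 0 this is the quotient rule: when [qk] and [remk] are unfolded in [dquotk z], the
    terms with b z^2 cancel and (z k' - k) / z^2 remains. *)
Lemma cderives_quotk (z : C) : Cmod z < 1 -> cderives quotk z (dquotk z).
Proof.
intros Hz. destruct (Ceq_dec z 0) as [->|Hz0]; [apply cderives_quotk_0|].
apply derives_local with (fun u => k u * / u)%C (Cmod z); [now apply Cmod_gt_0| |].
- intros u Hu. unfold quotk. destruct (Ceq_dec u 0) as [->|_]; [|reflexivity].
  replace (0 - z)%C with (- z)%C in Hu by ring. rewrite Cmod_opp in Hu. lra.
- pose proof (Re_one_minus_disk z Hz) as Hre.
  eapply derives_eq.
  + apply derives_mult; [now apply k_deriv|].
    apply derives_inv; [exact Hz0 | apply derives_index].
  + cbv beta. unfold dquotk, qk, remk.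
    assert (Hinv : Crpower (1 - z) (b + 1) = (/ Crpower (1 - z) (- b - 1))%C).
      rewrite <- Crpower_opp. f_equal. ring.
    rewrite Hinv. pose proof (Crpower_neq_0 (1 - z) (- b - 1)).
    replace (- b) with (- b - 1 + 1) at 1 by ring.
    rewrite Crpower_plus, Crpower_1 by easy.
    rewrite RtoC_div by lra. field. repeat split; auto; intros E; injection E; lra.
Qed.

(** * The convexity condition and the turning of the normal *)

(** A first-order differential equation for q. Its first term cancels the contribution of (1 -
    z)^(-b-1) to z h''/h', so that 1 + z h''/h' = 2/q - 1. *)
Lemma cderives_qk (z : C) : Cmod z < 1 -> z <> 0 ->
  cderives qk z (- RtoC (b + 1) * qk z / (1 - z) + 2 * (1 - qk z) / z)%C.
Proof.
intros Hz Hz0. pose proof (Re_one_minus_disk z Hz) as Hre.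
assert (HbC : RtoC b <> 0) by (intros E; injection E; lra).
apply derives_ext with (fun u => 1 + - / RtoC b *
  (Crpower (1 - u) (b + 1) * remk u * / (u * u)))%C.
  intros u. unfold qk. destruct (Ceq_dec u 0) as [->|Hu].
  - rewrite remk_0. unfold Cdiv. ring.
  - field. auto.
eapply derives_eq.
- apply derives_plus; [apply derives_const|].
  apply derives_mult; [apply derives_const|].
  apply derives_mult.
  + apply derives_mult; [now apply cderives_Crpower_one_minus | now apply cderives_remk].
  + apply derives_inv; [now apply Cmult_neq_0 | apply cderives_pow2].
- cbv beta. unfold qk.
  assert (Hw : (/ (1 - z))%C = Crpower (1 - z) (- (1)))
    by now rewrite Crpower_opp, Crpower_1.
  replace (Crpower (1 - z) (b + 1)) with (/ Crpower (1 - z) (- b - 2) * / (1 - z))%C.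
  2:{ rewrite Hw, <- Crpower_opp, <- Crpower_plus. f_equal. ring. }
  replace (Crpower (1 - z) (b + 1 - 1)) with
    (/ Crpower (1 - z) (- b - 2) * / (1 - z) * / (1 - z))%C.
  2:{ rewrite Hw, <- Crpower_opp, <- !Crpower_plus. f_equal. ring. }
  pose proof (Crpower_neq_0 (1 - z) (- b - 2)).
  pose proof (Cmod_lt_1_neq z Hz).
  rewrite RtoC_mult, RtoC_plus. field. auto.
Qed.

(* The argument of [circle z t * dquotk (circle z t)], minus that of [z]. *)
Definition darg (z : C) (t : R) : R :=
  t + Im (Clog (qk (circle z t))) + (- b - 1) * Im (Clog (1 - circle z t)).

(** Both q and 1 - z have positive real part on the disk, so their principal logarithms exponentiate
    back to them; [rho] collects the real parts and [darg] the imaginary parts. *)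
Lemma dquotk_polar (z : C) (t : R) : Cmod z < 1 ->
  exists rho, 0 < rho /\ (circle z t * dquotk (circle z t))%C =
    (z * (RtoC rho * Cexp (RtoC (darg z t) * Ci)))%C.
Proof.
intros Hz. assert (Hc : Cmod (circle z t) < 1) by now rewrite Cmod_circle.
set (q := qk (circle z t)). set (w := (1 - circle z t)%C).
exists (b / 2 * exp (Re (Clog q) + (- b - 1) * Re (Clog w))).
split; [apply Rmult_lt_0_compat; [lra | apply exp_pos]|].
unfold dquotk, darg. fold q w. unfold circle.
rewrite <- (Cexp_Clog q) at 1 by now apply Re_qk_pos.
unfold Crpower.
replace (z * Cexp (RtoC t * Ci) * (RtoC (b / 2) * Cexp (RtoC (- b - 1) * Clog w) *
  Cexp (Clog q)))%C with (z * (RtoC (b / 2) * (Cexp (RtoC t * Ci) *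
  (Cexp (RtoC (- b - 1) * Clog w) * Cexp (Clog q)))))%C by ring.
rewrite <- !Cexp_plus, RtoC_mult. rewrite <- (Cmult_assoc (RtoC (b / 2))).
f_equal. f_equal.
set (x := Re (Clog q) + (- b - 1) * Re (Clog w)).
replace (RtoC (exp x)) with (Cexp (RtoC x)).
2:{ unfold Cexp, Re, Im; simpl. rewrite cos_0, sin_0. unfold RtoC. f_equal; ring. }
rewrite <- Cexp_plus. f_equal. unfold x.
destruct (Clog q) as [q1 q2], (Clog w) as [w1 w2].
unfold Re, Im. apply injective_projections; simpl; ring.
Qed.

(** On a circle, the derivative of the argument of z h' with respect to the angle is Re (1 + z
    h''/h'). *)
Lemma is_derive_darg (z : C) (t : R) : 0 < Cmod z < 1 ->
  is_derive (darg z) t (Re (2 / qk (circle z t) - 1)).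
Proof.
intros [Hz0 Hz]. assert (Hc : Cmod (circle z t) < 1) by now rewrite Cmod_circle.
assert (Hc0 : circle z t <> 0) by (apply Cmod_gt_0; now rewrite Cmod_circle).
pose proof (Re_one_minus_disk _ Hc) as Hre.
apply is_derive_ext with (fun s => Re (RtoC s + - Ci *
  (Clog (qk (circle z s)) + RtoC (- b - 1) * Clog (1 - circle z s)))).
  intros s. unfold darg.
  destruct (Clog (qk (circle z s))) as [q1 q2], (Clog (1 - circle z s)) as [w1 w2].
  unfold Re, Im; simpl; ring.
apply (rderives_Re (fun s => RtoC s + - Ci *
  (Clog (qk (circle z s)) + RtoC (- b - 1) * Clog (1 - circle z s)))%C).
eapply derives_eq.
- apply derives_plus; [apply derives_index|].
  apply derives_mult; [apply derives_const|].
  apply derives_plus; [|apply derives_mult; [apply derives_const|]].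
  + apply (derives_comp _ (fun s => qk (circle z s)) Clog).
    * apply (derives_comp _ (circle z) qk); [apply rderives_circle | now apply cderives_qk].
    * now apply cderives_Clog, Re_qk_pos.
  + apply (derives_comp _ (fun s => 1 - circle z s)%C Clog); [|now apply cderives_Clog].
    apply (derives_comp _ (circle z) (fun u => 1 - u)%C); [apply rderives_circle|].
    apply cderives_one_minus.
- cbv beta. pose proof (qk_neq_0 _ Hc). pose proof (Cmod_lt_1_neq _ Hc).
  rewrite RtoC_minus, RtoC_opp, RtoC_plus.
  set (c := circle z t) in *. set (q := qk c) in *.
  assert (HJ : (Ci * Ci)%C = (- (1))%C) by (apply injective_projections; simpl; ring).
  (* [Ci] is opaque to [ring] and [field], so its square is isolated first and then replaced by
     -1. *)
  transitivity (1 + - (Ci * Ci) * (/ q * (- (RtoC b + 1) * q / (1 - c) + 2 * (1 - q) / c) * c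
    + (RtoC b + 1) * c / (1 - c)))%C.
  + unfold Cdiv. ring.
  + rewrite HJ. field. auto.
Qed.

Lemma darg_increasing (z : C) (s t : R) : 0 < Cmod z < 1 -> s < t -> darg z s < darg z t.
Proof.
intros Hz Hst.
destruct (MVT_cor2 (darg z) (fun x => Re (2 / qk (circle z x) - 1)) s t Hst) as (c & E & _).
- intros x _. now apply is_derive_Reals, is_derive_darg.
- assert (0 < Re (2 / qk (circle z c) - 1)).
    apply Re_two_div_qk. now rewrite Cmod_circle.
  assert (0 < Re (2 / qk (circle z c) - 1) * (t - s)) by (apply Rmult_lt_0_compat; lra).
  lra.
Qed.

(** Both logarithms return to their initial values after one turn, so only the term [t]
    contributes. *)
Lemma darg_2PI (z : C) : darg z (2 * PI) = darg z 0 + 2 * PI.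
Proof. unfold darg. rewrite circle_2PI, circle_0. ring. Qed.

(** * Supporting lines of the images of disks *)

(** [F] vanishes at both ends of the turn and its derivative has the sign of the sine of an angle
    that increases from 0 to 2 pi. Hence [F] first rises and then falls, and is positive in
    between. *)
Lemma support_on_circle (z : C) (t : R) : 0 < Cmod z < 1 -> 0 < t < 2 * PI ->
  0 < Re ((quotk z - quotk (circle z t)) * Cconj (z * dquotk z)).
Proof.
intros Hz Ht.
set (N := Cconj (z * dquotk z)).
set (F := fun s => Re ((quotk z - quotk (circle z s)) * N)).
set (dF := fun s => Im (circle z s * dquotk (circle z s) * N)).
assert (HF : forall s, derivable_pt_lim F s (dF s)).
  intros s. apply is_derive_Reals.
  apply is_derive_ext with (fun s => Re (- N * (quotk (circle z s) + - quotk z))).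
    intros u. unfold F. f_equal. ring.
  replace (dF s) with (Re (- N * (dquotk (circle z s) * (Ci * circle z s)))).
  2:{ unfold dF. replace (- N * (dquotk (circle z s) * (Ci * circle z s)))%C with
        (- (circle z s * dquotk (circle z s) * N * Ci))%C by ring.
      rewrite re_opp, re_mult_Ci. ring. }
  apply (rderives_Re (fun s => - N * (quotk (circle z s) + - quotk z))%C).
  eapply derives_eq.
  - apply derives_mult; [apply derives_const|].
    apply derives_plus; [|apply derives_const].
    apply (derives_comp _ (circle z) quotk); [apply rderives_circle|].
    apply cderives_quotk. now rewrite Cmod_circle.
  - cbv beta; ring.
assert (HdF : forall s, exists rho, 0 < rho /\ dF s = rho * sin (darg z s - darg z 0)).
  intros s.
  destruct (dquotk_polar z s (proj2 Hz)) as (r1 & Hr1 & E1).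
  destruct (dquotk_polar z 0 (proj2 Hz)) as (r0 & Hr0 & E0).
  rewrite circle_0 in E0.
  exists (Cmod z ^ 2 * r1 * r0); split.
    assert (0 < Cmod z ^ 2) by apply pow_lt, Hz.
    now do 2 (apply Rmult_lt_0_compat; auto).
  unfold dF, N. rewrite E1, E0, sin_minus, Cmod2_alt.
  rewrite !Cexp_Ci. unfold Re, Im. simpl. ring.
assert (F0 : F 0 = 0).
  unfold F. rewrite circle_0. replace ((quotk z - quotk z) * N)%C with (RtoC 0) by ring. reflexivity.
assert (F1 : F (2 * PI) = 0).
  unfold F. rewrite circle_2PI. replace ((quotk z - quotk z) * N)%C with (RtoC 0) by ring. reflexivity.
change (0 < F t).
pose proof (darg_2PI z) as L1.
(* [F t] is compared with the endpoint from which the sine keeps one sign: the start if the angle at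
   [t] is at most pi, the end otherwise. *)
destruct (Rle_lt_dec (darg z t - darg z 0) PI) as [Hle|Hgt].
- destruct (MVT_cor2 F dF 0 t (proj1 Ht)) as (c & E & Hc); [auto|].
  destruct (HdF c) as (rho & Hrho & Ec).
  assert (0 < sin (darg z c - darg z 0)).
    pose proof (darg_increasing z 0 c Hz (proj1 Hc)).
    pose proof (darg_increasing z c t Hz (proj2 Hc)).
    apply sin_gt_0; lra.
  assert (0 < dF c) by (rewrite Ec; now apply Rmult_lt_0_compat). nra.
- destruct (MVT_cor2 F dF t (2 * PI) (proj2 Ht)) as (c & E & Hc); [auto|].
  destruct (HdF c) as (rho & Hrho & Ec).
  assert (sin (darg z c - darg z 0) < 0).
    pose proof (darg_increasing z t c Hz (proj1 Hc)).
    pose proof (darg_increasing z c (2 * PI) Hz (proj2 Hc)).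
    apply sin_lt_0; lra.
  assert (dF c < 0) by (rewrite Ec; nra). nra.
Qed.

Lemma quotk_continuous (z : C) : Cmod z < 1 -> forall eps, 0 < eps ->
  exists d, 0 < d /\ forall u, Cmod (u - z) < d -> Cmod (quotk u - quotk z) < eps.
Proof. intros Hz. now apply (derives_continuous (fun z => z) quotk z (dquotk z)), cderives_quotk. Qed.

(** As h' does not vanish, moving [p] slightly in the direction [Cconj (N * dquotk p)] increases the
    functional. *)
Lemma linear_interior_max (N p : C) (r : R) : N <> 0 -> r < 1 -> Cmod p < r ->
  exists u, Cmod u <= r /\ Re (N * quotk p) < Re (N * quotk u).
Proof.
intros HN Hr Hp.
assert (Hd : cderives quotk p (dquotk p)) by (apply cderives_quotk; lra).
assert (Hnz : (N * dquotk p)%C <> 0) by (apply Cmult_neq_0; [easy | apply dquotk_neq_0; lra]).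
set (v := Cconj (N * dquotk p)).
destruct (linear_decrease quotk p (dquotk p) (- N) v Hd) as (e1 & He1 & H1).
  replace (- N * dquotk p * v)%C with (- (N * dquotk p * Cconj (N * dquotk p)))%C
    by (unfold v; ring).
  rewrite <- Cmod2_conj, re_opp. apply Cmod_gt_0 in Hnz.
  pose proof (pow_lt _ 2 Hnz). unfold Re; simpl in *. lra.
destruct (ball_radius p v r Hp) as (e2 & He2 & H2).
set (s := Rmin e1 e2 / 2).
assert (Hs : 0 < s < Rmin e1 e2) by (unfold s; assert (0 < Rmin e1 e2) by (now apply Rmin_pos); lra).
pose proof (Rmin_l e1 e2). pose proof (Rmin_r e1 e2).
exists (p + RtoC s * v)%C. split; [apply H2; lra|].
specialize (H1 s ltac:(lra)).
assert (Eo : forall q, Re (- N * q) = - Re (N * q)) by (intros; unfold Re; simpl; ring).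
rewrite !Eo in H1. lra.
Qed.

(* [z * dquotk z] is an outward normal to the image of the circle of radius [Cmod z]: the image of the closed disk lies on one side of the tangent line, touching it at [quotk z] only. *)
Lemma support_on_disk (z w : C) : 0 < Cmod z < 1 -> Cmod w <= Cmod z -> w <> z ->
  0 < Re ((quotk z - quotk w) * Cconj (z * dquotk z)).
Proof.
intros Hz Hw Hne.
assert (Hcirc : forall u, Cmod u = Cmod z -> u <> z ->
    0 < Re ((quotk z - quotk u) * Cconj (z * dquotk z))).
  intros u Hu Hune. destruct (circle_surj z u (proj1 Hz) Hu) as (t & Ht & ->).
  apply support_on_circle; auto.
  destruct (Req_dec t 0) as [->|]; [elim Hune; apply circle_0|].
  destruct (Req_dec t (2 * PI)) as [->|]; [elim Hune; apply circle_2PI|]. lra.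
destruct (Req_dec (Cmod w) (Cmod z)) as [He|He]; [now apply Hcirc|].
set (N := Cconj (z * dquotk z)) in *.
assert (HN : N <> 0).
  apply Cmod_gt_0. unfold N. rewrite Cmod_conj. apply Cmod_gt_0, Cmult_neq_0.
  - now apply Cmod_gt_0.
  - now apply dquotk_neq_0.
assert (Er : forall u, Re ((quotk z - quotk u) * N) = Re (N * quotk z) - Re (N * quotk u))
  by (intros; unfold Re; simpl; ring).
(* A maximum point [p] of the functional lies on the circle, where the circle case bounds its value
   by that at [z]. The interior point [w] is strictly below some value, hence below the maximum. *)
destruct (attains_min (fun u => Cmod u <= Cmod z) (Cmod z) (fun u => - Re (N * quotk u)))
  as (p & Hp & Hmin); auto using closed_disk_complement.
- exists z. lra.
- intros u Hu eps Heps.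
  assert (HNpos := proj1 (Cmod_gt_0 N) HN).
  destruct (quotk_continuous u ltac:(lra) (eps / Cmod N)) as (d & Hd & H).
    now apply Rdiv_lt_0_compat.
  exists d; split; auto. intros v Hv. specialize (H v Hv).
  replace (- Re (N * quotk v) - - Re (N * quotk u)) with (- Re (N * (quotk v - quotk u)))
    by (unfold Re; simpl; ring).
  rewrite Rabs_Ropp. eapply Rle_lt_trans; [apply re_le_Cmod|]. rewrite Cmod_mult.
  apply Rmult_lt_compat_l with (r := Cmod N) in H; [|easy].
  replace (Cmod N * (eps / Cmod N)) with eps in H by (field; lra). exact H.
- assert (Hpr : Cmod p = Cmod z).
    destruct Hp as [Hp|Hp]; [|easy].
    destruct (linear_interior_max N p (Cmod z) HN ltac:(lra) Hp) as (u & Hu & Hlt).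
    specialize (Hmin u Hu). lra.
  assert (Hpz : Re (N * quotk p) <= Re (N * quotk z)).
    destruct (Ceq_dec p z) as [->|Hpz]; [lra|].
    specialize (Hcirc p Hpr Hpz). rewrite Er in Hcirc. lra.
  destruct (linear_interior_max N w (Cmod z) HN ltac:(lra) ltac:(lra)) as (u & Hu & Hlt).
  specialize (Hmin u Hu). rewrite Er. lra.
Qed.

(** * Injectivity, convexity and openness of the image *)

Lemma quotk_injective : injective_on unit_disk quotk.
Proof.
assert (H : forall z w, Cmod z < 1 -> Cmod w <= Cmod z -> quotk z = quotk w -> z = w).
  intros z w Hz Hw E. destruct (Ceq_dec w z) as [->|Hne]; auto.
  assert (Hz0 : 0 < Cmod z).
    apply Cmod_gt_0. intros ->. rewrite Cmod_0 in Hw.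
    apply Hne, Cmod_eq_0, Rle_antisym; auto. apply Cmod_ge_0. 
  pose proof (support_on_disk z w (conj Hz0 Hz) Hw Hne) as P.
  rewrite E in P. replace (quotk w - quotk w)%C with (RtoC 0) in P by ring.
  rewrite Cmult_0_l in P. simpl in P. lra.
intros z w Hz Hw E. unfold unit_disk in *.
destruct (Rle_lt_dec (Cmod w) (Cmod z)) as [L|L]; [now apply H|].
symmetry. apply H; auto. lra.
Qed.

(** Solves h = w by minimising the distance over a closed disk. At an interior minimum with h
    different from [w], a step against the gradient would decrease the distance, as h' is
    nonzero. *)
Lemma quotk_nearest (w : C) (r : R) : 0 < r < 1 ->
  exists p, Cmod p <= r /\
    (forall z, Cmod z <= r -> Cmod (quotk p - w) <= Cmod (quotk z - w)) /\
    (Cmod p < r -> quotk p = w).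
Proof.
intros Hr.
destruct (attains_min (fun u => Cmod u <= r) r (fun u => Cmod (quotk u - w)))
  as (p & Hp & Hmin); auto using closed_disk_complement.
- exists (RtoC 0). rewrite Cmod_0. lra.
- intros z Hz eps He. destruct (quotk_continuous z ltac:(lra) eps He) as (d & Hd & H).
  exists d; split; auto. intros u Hu. specialize (H u Hu).
  eapply Rle_lt_trans; [apply Cmod_triangle_rev|].
  now replace (quotk u - w - (quotk z - w))%C with (quotk u - quotk z)%C by ring.
- exists p. repeat split; auto. intros Hpr.
  apply NNPP. intros Hne.
  assert (Hd : cderives quotk p (dquotk p)) by (apply cderives_quotk; lra).
  set (c := (Cconj (quotk p - w) * dquotk p)%C).
  assert (Hc : c <> 0).
    apply Cmult_neq_0; [|apply dquotk_neq_0; lra].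
    apply Cmod_gt_0. rewrite Cmod_conj. apply Cmod_gt_0. intros E. apply Hne.
    replace (quotk p) with (quotk p - w + w)%C by ring. rewrite E. ring.
  destruct (distance_decrease quotk p (dquotk p) w (- Cconj c) Hd) as (e1 & He1 & H1).
    fold c. replace (c * - Cconj c)%C with (- (c * Cconj c))%C by ring.
    rewrite <- Cmod2_conj, re_opp. apply Cmod_gt_0 in Hc.
    pose proof (pow_lt _ 2 Hc). unfold Re; simpl in *. lra.
  destruct (ball_radius p (- Cconj c) r Hpr) as (e2 & He2 & H2).
  set (s := Rmin e1 e2 / 2).
  assert (Hs : 0 < s < Rmin e1 e2)
    by (unfold s; assert (0 < Rmin e1 e2) by (now apply Rmin_pos); lra).
  pose proof (Rmin_l e1 e2). pose proof (Rmin_r e1 e2).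
  specialize (H1 s ltac:(lra)). specialize (Hmin _ (H2 s ltac:(lra))). lra.
Qed.

(** If the nearest point [p] were on the circle, both ends of the chord would lie strictly inside
    the supporting line at [quotk p], hence so would [w]. Moving [p] radially inwards would then
    bring its image closer to [w]. *)
Lemma quotk_image_convex : convex_set (image_set quotk unit_disk).
Proof.
intros y1 y2 t [z1 [Hz1 <-]] [z2 [Hz2 <-]] Ht. unfold unit_disk in *.
set (w := (RtoC (1 - t) * quotk z1 + RtoC t * quotk z2)%C).
set (r := (Rmax (Cmod z1) (Cmod z2) + 1) / 2).
assert (Hm1 := Rmax_l (Cmod z1) (Cmod z2)). assert (Hm2 := Rmax_r (Cmod z1) (Cmod z2)).
assert (Hm3 : Rmax (Cmod z1) (Cmod z2) < 1) by now apply Rmax_lub_lt.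
pose proof (Cmod_ge_0 z1).
assert (Hr : 0 < r < 1 /\ Cmod z1 < r /\ Cmod z2 < r) by (unfold r; lra).
destruct Hr as (Hr & Hr1 & Hr2).
destruct (quotk_nearest w r Hr) as (p & Hp & Hmin & Hsol).
exists p. split; [lra|].
destruct Hp as [Hp|Hp]; [auto|exfalso].
assert (Hp' : 0 < Cmod p < 1) by lra.
assert (P1 := support_on_disk p z1 Hp' ltac:(lra) ltac:(intros ->; lra)).
assert (P2 := support_on_disk p z2 Hp' ltac:(lra) ltac:(intros ->; lra)).
assert (Hd : cderives quotk p (dquotk p)) by (apply cderives_quotk; lra).
destruct (distance_decrease quotk p (dquotk p) w (- p) Hd) as (e & He & H1).
  replace (Re (Cconj (quotk p - w) * dquotk p * - p)) with
    (- ((1 - t) * Re ((quotk p - quotk z1) * Cconj (p * dquotk p)) +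
        t * Re ((quotk p - quotk z2) * Cconj (p * dquotk p)))).
  2:{ unfold w, Re; simpl; ring. }
  destruct (Req_dec t 0) as [->|]; nra.
set (s := Rmin e 1 / 2).
assert (Hs : 0 < s < Rmin e 1) by (unfold s; assert (0 < Rmin e 1) by (apply Rmin_pos; lra); lra).
pose proof (Rmin_l e 1). pose proof (Rmin_r e 1).
specialize (H1 s ltac:(lra)).
assert (Hin : Cmod (p + RtoC s * - p) <= r).
  replace (p + RtoC s * - p)%C with (RtoC (1 - s) * p)%C by (rewrite RtoC_minus; ring).
  rewrite Cmod_mult, Cmod_R, Rabs_pos_eq by lra. nra.
specialize (Hmin _ Hin). lra.
Qed.

(** By injectivity the image of a larger circle stays at a distance [m > 0] from [quotk z0]. For [w]
    within [m / 2] of [quotk z0], every point of that image is farther from [w] than [quotk z0] is,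
    so the nearest point is interior and solves the equation. *)
Lemma quotk_image_open : open (image_set quotk unit_disk).
Proof.
apply Cmod_open. intros w0 [z0 [Hz0 <-]]. unfold unit_disk in Hz0.
pose proof (Cmod_ge_0 z0).
set (r := (Cmod z0 + 1) / 2).
assert (Hr : 0 < r < 1 /\ Cmod z0 < r) by (unfold r; lra). destruct Hr as (Hr & Hr0).
destruct (attains_min (fun u => Cmod u = r) r (fun u => Cmod (quotk u - quotk z0)))
  as (q & Hq & Hmin); auto using circle_complement.
- intros z Hz. lra.
- exists (RtoC r). rewrite Cmod_R, Rabs_pos_eq; lra.
- intros z Hz eps He. destruct (quotk_continuous z ltac:(lra) eps He) as (d & Hd & H').
  exists d; split; auto. intros u Hu. specialize (H' u Hu).
  eapply Rle_lt_trans; [apply Cmod_triangle_rev|].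
  now replace (quotk u - quotk z0 - (quotk z - quotk z0))%C with (quotk u - quotk z)%C by ring.
- set (m := Cmod (quotk q - quotk z0)) in *.
  assert (Hm : 0 < m).
    apply Cmod_gt_0. intros E.
    assert (Eq : q = z0).
      apply quotk_injective; unfold unit_disk; try lra.
      replace (quotk q) with (quotk q - quotk z0 + quotk z0)%C by ring. rewrite E. ring.
    rewrite Eq in Hq. lra.
  exists (m / 2); split; [lra|]. intros w Hw.
  destruct (quotk_nearest w r Hr) as (p & Hp & Hpmin & Hsol).
  exists p. split; [unfold unit_disk; lra|].
  destruct Hp as [Hp|Hp]; [auto|exfalso].
  specialize (Hpmin z0 ltac:(lra)). specialize (Hmin p Hp).
  pose proof (Cmod_triangle (quotk p - w) (w - quotk z0)) as T.
  replace (quotk p - w + (w - quotk z0))%C with (quotk p - quotk z0)%C in T by ring.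
  replace (quotk z0 - w)%C with (- (w - quotk z0))%C in Hpmin by ring.
  rewrite Cmod_opp in Hpmin. lra.
Qed.

Lemma quotk_univalent_convex :
  univalent_on unit_disk quotk /\
  is_domain (image_set quotk unit_disk) /\
  convex_set (image_set quotk unit_disk).
Proof.
split; [split|split].
- intros z Hz. apply ex_derive_cderives with (dquotk z). now apply cderives_quotk.
- apply quotk_injective.
- split; [|split].
  + exists (quotk 0), 0. split; [|reflexivity]. unfold unit_disk. rewrite Cmod_0. lra.
  + apply quotk_image_open.
  + apply convex_connected, quotk_image_convex.
- apply quotk_image_convex.
Qed.

End Koebe.

(** * The functions k_alpha *)

Lemma kfun_0 (alpha : R) : kfun alpha 0 = 0.
Proof.
unfold kfun. replace (1 - 0)%C with (RtoC 1) by ring.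
destruct Req_dec_T as [_|_].
- assert (E : Clog 1 = 0).
    rewrite Clog_atan by (simpl; lra).
    replace (Im 1 / Re 1) with 0 by (simpl; field).
    now rewrite Cmod_1, ln_1, atan_0.
  rewrite E. ring.
- rewrite Crpower_at_1. ring.
Qed.

(** The logarithm and the power share the derivative (1 - z)^(2 alpha - 2); at alpha = 1/2 the
    exponent is -1. *)
Lemma cderives_kfun (alpha : R) (z : C) : 0 < Re (1 - z) ->
  cderives (kfun alpha) z (Crpower (1 - z) (- (2 - 2 * alpha))).
Proof.
intros Hz. unfold kfun. destruct Req_dec_T as [->|Ha].
- apply derives_ext with (fun u => - (1) * Clog (1 - u))%C; [intros; ring|].
  eapply derives_eq.
  + apply derives_mult; [apply derives_const|].
    apply (derives_comp _ (fun u => 1 - u)%C Clog); [apply cderives_one_minus|].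
    now apply cderives_Clog.
  + cbv beta. replace (- (2 - 2 * (1 / 2))) with (- (1)) by field.
    rewrite Crpower_opp, Crpower_1 by easy. ring.
- apply derives_ext with (fun u => / RtoC (1 - 2 * alpha) *
    (Crpower (1 - u) (2 * alpha - 1) + - (1)))%C; [intros; ring|].
  eapply derives_eq.
  + apply derives_mult; [apply derives_const|].
    apply derives_plus; [now apply cderives_Crpower_one_minus | apply derives_const].
  + cbv beta. replace (2 * alpha - 1 - 1) with (- (2 - 2 * alpha)) by ring.
    replace (2 * alpha - 1) with (- (1 - 2 * alpha)) by ring.
    rewrite RtoC_opp. field. intros E; injection E; lra.
Qed.

Theorem theorem1p1 (alpha : R) (Halpha : 0 <= alpha < 1) :
  univalent_on unit_disk (hfun alpha) /\
  is_domain (image_set (hfun alpha) unit_disk) /\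
  convex_set (image_set (hfun alpha) unit_disk).
Proof.
exact (quotk_univalent_convex (2 - 2 * alpha) ltac:(lra) (kfun alpha) (kfun_0 alpha)
  (cderives_kfun alpha)).
Qed.
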